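(* Let $k\ge3$. On a cuboid cell $T$ let $\boldsymbol\Sigma_T$ be the space of symmetric matrix fields $\boldsymbol\sigma$ with $\sigma_{ii}\in\mathcal Q(i{:}k-2,j{:}k,l{:}k)$ for each $i$, and $\sigma_{ij}=\sigma_{ji}\in\mathcal Q(i{:}k-1,j{:}k-1,l{:}k)$ for $i\ne j$. The following degrees of freedom are unisolvent for $\boldsymbol\Sigma_T$. For each diagonal entry $\sigma_{ii}$: (a) moments of $\sigma_{ii}$ on each edge $e_i$ against $\mathcal Q(i{:}k-2)$; (b) for each $j\neq i$, moments of $\sigma_{ii}$ on each face $F_{ij}$ against $\mathcal Q(i{:}k-2,j{:}k-2)$; (c) moments of $\sigma_{ii}$ on $T$ against $\mathcal Q_{k-2,k-2,k-2}$. For each off-diagonal entry $\sigma_{ij}$, $i<j$: (a) $\sigma_{ij}$ and $\partial_l\sigma_{ij}$ at each vertex; (b) moments of $\sigma_{ij},\partial_l\sigma_{ij}$ on each edge $e_i$ against $\mathcal Q(i{:}k-3)$ and on each edge $e_j$ against $\mathcal Q(j{:}k-3)$; (c) moments of $\sigma_{ij}$ on each edge $e_l$ against $\mathcal Q(l{:}k-4)$; (d) moments of $\sigma_{ij}$ on each face $F_{ij}$ against $\mathcal Q(i{:}k-3,j{:}k-3)$; (e) moments of $\sigma_{ij}$ on each face $F_{il}$ against $\mathcal Q(i{:}k-3,l{:}k-4)$ and on each face $F_{jl}$ against $\mathcal Q(j{:}k-3,l{:}k-4)$; (f) moments of $\sigma_{ij}$ on $T$ against $\mathcal Q(i{:}k-3,j{:}k-3,l{:}k-2)$.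 Moreover, the resulting finite element space $\widetilde{\boldsymbol\Sigma}_h$ on $\mathcal T_h$ is $\boldsymbol H(\operatorname{curl};\mathbb S)$ conforming, i.e. $\widetilde{\boldsymbol\Sigma}_h\subset\boldsymbol H(\operatorname{curl},\Omega;\mathbb S)$.
   Context: Coordinates are $(x_1,x_2,x_3)=(x,y,z)$, $\partial_i=\partial/\partial x_i$. Whenever indices $i,j,l$ occur together they are pairwise distinct, i.e. $\{i,j,l\}=\{1,2,3\}$. $\mathcal Q(i{:}a,j{:}b,l{:}c)$ is the space of polynomials of degree at most $a$ in $x_i$, at most $b$ in $x_j$ and at most $c$ in $x_l$ (separately); similarly with fewer variables on faces and edges; it is the zero space if some bound is negative (the corresponding degrees of freedom are then absent). $\mathcal Q_{a,b,c}=\mathcal Q(1{:}a,2{:}b,3{:}c)$. $\mathbb M$, $\mathbb S$ are the real $3\times3$ matrices and the symmetric ones; $\operatorname{curl}$ acts row-wise on matrix fields; $\boldsymbol H(\operatorname{curl},\Omega;\mathbb S)=\{\boldsymbol v\in L^2(\Omega;\mathbb S):\operatorname{curl}\boldsymbol v\in L^2(\Omega;\mathbb M)\}$. $\Omega\subset\mathbb R^3$ is a contractible domain with Lipschitz boundary, partitioned by a (face-to-face) mesh $\mathcal T_h$ of axis-parallel cuboids. $e_i$ denotes an edge parallel to the $x_i$-axis; $F_{ij}=F_{ji}$ denotes a face parallel to the $x_i$- and $x_j$-axes. ''Moments of $f$ on $G$ against $P$'' means the functionals $\int_G f\,p$, $p\in P$ (with $p$ running over a basis of $P$ when counting). Degrees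 of freedom are unisolvent for a shape function space if they form a basis of its dual space. The resulting finite element space consists of all fields on $\Omega$ whose restriction to each cell is in the shape function space and such that each degree of freedom attached to a vertex, edge or face has the same value from all cells containing that vertex, edge or face. *)

(* Defs.v *)
From HB Require Import structures.
From mathcomp Require Import all_boot all_order all_algebra.
From mathcomp Require Import all_classical all_reals all_analysis.
From mathcomp Require Import (canonicals, coercions) mpoly.

Set Implicit Arguments.
Unset Strict Implicit.
Unset Printing Implicit Defensive.

Import Order.TTheory GRing.Theory Num.Theory.
Import numFieldNormedType.Exports.

Local Open Scope classical_set_scope.
Local Open Scope ring_scope.

(** Points of R^3 are row vectors [x : 'rV[R]_3]; the directions x_1, x_2, x_3
    are indexed by 'I_3 = {0, 1, 2}, on which [+] is addition modulo 3. *)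

(** * Linear algebra *)

(* The list [b] is a basis of the subspace [S] of [V], which need not be finite
   dimensional. *)
Definition is_basis (R : pzRingType) (V : lmodType R) (S : set V) (b : seq V) :=
  (forall i, (i < size b)%N -> S b`_i) /\
  (forall v, S v ->
     exists! c : 'rV[R]_(size b), v = \sum_(i < size b) c 0 i *: b`_i).

(* The dual space of the subspace [S]: the functionals live on the subtype
   [set_type S] only. *)
Definition dual (R : pzRingType) (V : lmodType R) (S : set V) :
    set (set_type S -> R^o) :=
  [set psi | forall (a : R) (u v w : set_type S),
     set_val w = a *: set_val u + set_val v -> psi w = a * psi u + psi v].

(** * Polynomial spaces *)

(* The degree bounds (i1:a1, i2:a2, ...), written [:: (i1, a1); (i2, a2); ...]
   with distinct indices. A variable that is not listed gets the bound 0, i.e.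
   does not occur. *)
Definition deg (s : seq ('I_3 * int)) (m : 'I_3) : int :=
  \sum_(q <- s | q.1 == m) q.2.

(* Polynomial functions of degree at most [deg s m] in x_m for each m. The
   bounds are integers, so that the space is zero if one of them is negative. *)
Definition Qpoly (R : realType) (s : seq ('I_3 * int)) : set ('rV[R]_3 -> R) :=
  [set f | exists p : mpoly.mpoly 3 R,
     (forall m, m \in mpoly.msupp p ->
        forall i : 'I_3, (m i)%:Z <= deg s i) /\
     (forall x : 'rV[R]_3, f x = mpoly.meval (x 0) p)].

(* A polynomial field on a cell is identified with its extension to R^3, so that
   the shape function space does not depend on the cell. *)
Definition Sigma (R : realType) (k : nat) : set ('rV[R]_3 -> 'M[R]_3) :=
  [set s |
    [/\ forall x, (s x)^T = s x,
        forall i j l : 'I_3, uniq [:: i; j; l] ->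
          @Qpoly R [:: (i, k%:Z - 2); (j, k%:Z); (l, k%:Z)]
                 (fun x => s x i i)
      & forall i j l : 'I_3, uniq [:: i; j; l] ->
          @Qpoly R [:: (i, k%:Z - 1); (j, k%:Z - 1); (l, k%:Z)]
                 (fun x => s x i j)]].

Definition partial (R : realType) (i : 'I_3) (f : 'rV[R]_3 -> R) (x : 'rV[R]_3)
  : R := 'D_(delta_mx 0 i) f x.

(** * Cuboids, and their vertices, edges and faces *)

Record cuboid (R : realType) := Cuboid {
  lo : 'rV[R]_3;
  hi : 'rV[R]_3;
  lo_lt_hi : [forall i, lo 0 i < hi 0 i] }.

(* A vertex, edge, face or the whole of a cuboid: [E i = None] if it extends in
   the direction x_i, and [E i = Some b] if x_i is fixed to its lower
   ([b = false]) or upper ([b = true]) bound. *)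
Definition entity := {ffun 'I_3 -> option bool}.

Definition cell_entity : entity := [ffun=> None].

Definition spans (E : entity) (D : seq 'I_3) : bool :=
  [forall m, (E m == None) == (m \in D)].

Definition bound (R : realType) (T : cuboid R) (b : bool) (i : 'I_3) : R :=
  if b then hi T 0 i else lo T 0 i.

Definition points (R : realType) (T : cuboid R) (E : entity) : set 'rV[R]_3 :=
  [set x | forall i, match E i with
                     | Some b => x 0 i = bound T b i
                     | None => lo T 0 i <= x 0 i <= hi T 0 i
                     end].

Definition cell (R : realType) (T : cuboid R) : set 'rV[R]_3 :=
  points T cell_entity.

Definition open_cell (R : realType) (T : cuboid R) : set 'rV[R]_3 :=
  [set x | forall i, lo T 0 i < x 0 i < hi T 0 i].

Definition set_coord (R : realType) (x : 'rV[R]_3) (i : 'I_3) (t : R)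
  : 'rV[R]_3 := \row_j (if j == i then t else x 0 j).

(* Integration in x_i over the extent of [E] in that direction. *)
Definition int_dir (R : realType) (T : cuboid R) (E : entity) (i : 'I_3)
    (f : 'rV[R]_3 -> R) : 'rV[R]_3 -> R :=
  if E i is None then
    fun x => \int[@lebesgue_measure R]_(t in `[lo T 0 i, hi T 0 i])
               f (set_coord x i t)
  else f.

(* The integral of [f] over [points T E], as an iterated integral; it is the
   value of [f] if [E] is a vertex. *)
Definition int_entity (R : realType) (T : cuboid R) (E : entity)
    (f : 'rV[R]_3 -> R) : R :=
  int_dir T E 0 (int_dir T E 1 (int_dir T E 2%:R f))
    (\row_i bound T (odflt false (E i)) i).

(** * Degrees of freedom *)

(* [DofKind i j der s] stands for the degrees of freedom of the function f that
   is sigma_ij if [der = None], and its derivative in x_l if [der = Some l]: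
   - if [s] is [:: (i1, a1); ...], moments of f against Q(i1:a1, ...) on each
     edge, face or cell parallel to the directions i1, ...;
   - if [s] is empty, the value of f at each vertex. *)
Record dof_kind := DofKind {
  dof_row : 'I_3;
  dof_col : 'I_3;
  dof_der : option 'I_3;
  dof_tests : seq ('I_3 * int) }.

Definition dof_kind_tuple (g : dof_kind) :=
  (dof_row g, dof_col g, dof_der g, dof_tests g).
Definition tuple_dof_kind (q : 'I_3 * 'I_3 * option 'I_3 * seq ('I_3 * int)) :=
  let: (i, j, der, s) := q in DofKind i j der s.
Lemma dof_kind_tupleK : cancel dof_kind_tuple tuple_dof_kind.
Proof. by case. Qed.
HB.instance Definition _ := Equality.copy dof_kind (can_type dof_kind_tupleK).

Definition diag_kinds (k : nat) (i : 'I_3) : seq dof_kind :=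
  DofKind i i None [:: (i, k%:Z - 2)]
  :: [seq DofKind i i None [:: (i, k%:Z - 2); (j, k%:Z - 2)]
       | j <- enum 'I_3 & j != i]
  ++ [:: DofKind i i None [seq (m, k%:Z - 2) | m <- enum 'I_3]].

Definition offdiag_kinds (k : nat) (i j l : 'I_3) : seq dof_kind :=
  [:: DofKind i j None [::];
      DofKind i j (Some l) [::];
      DofKind i j None [:: (i, k%:Z - 3)];
      DofKind i j (Some l) [:: (i, k%:Z - 3)];
      DofKind i j None [:: (j, k%:Z - 3)];
      DofKind i j (Some l) [:: (j, k%:Z - 3)];
      DofKind i j None [:: (l, k%:Z - 4)];
      DofKind i j None [:: (i, k%:Z - 3); (j, k%:Z - 3)];
      DofKind i j None [:: (i, k%:Z - 3); (l, k%:Z - 4)];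
      DofKind i j None [:: (j, k%:Z - 3); (l, k%:Z - 4)];
      DofKind i j None [:: (i, k%:Z - 3); (j, k%:Z - 3); (l, k%:Z - 2)]].

Definition dof_kinds (k : nat) : seq dof_kind :=
  flatten [seq diag_kinds k i | i <- enum 'I_3] ++
  flatten [seq offdiag_kinds k q.1.1 q.1.2 q.2
            | q : 'I_3 * 'I_3 * 'I_3 <- enum {: 'I_3 * 'I_3 * 'I_3}
            & (q.1.1 < q.1.2)%N && uniq [:: q.1.1; q.1.2; q.2]].

(* The degree of freedom of kind [g] at the entity [E] of the cell [T], with
   test function [p]; at a vertex, take [p = 1]. *)
Definition dof (R : realType) (T : cuboid R) (g : dof_kind) (E : entity)
    (p : 'rV[R]_3 -> R) (s : 'rV[R]_3 -> 'M[R]_3) : R :=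
  let f x := s x (dof_row g) (dof_col g) in
  let h := if dof_der g is Some l then partial l f else f in
  int_entity T E (fun x => h x * p x).

(* All the degrees of freedom on [T], as functionals on [Sigma k], when the test
   functions at the entity [E] run through the list [B g E]. *)
Definition dofs (R : realType) (k : nat) (T : cuboid R)
    (B : dof_kind -> entity -> seq ('rV[R]_3 -> R)) :
    seq (set_type (@Sigma R k) -> R^o) :=
  [seq (fun s => dof T q.1.1 q.1.2 q.2 (set_val s))
    | q <- flatten [seq [seq (g, E, p)
                          | p <- if nilp (dof_tests g) then [:: cst 1]
                                 else B g E]
                     | g <- dof_kinds k,
                       E <- [seq E <- enum {: entity}
                              | spans E (unzip1 (dof_tests g))]]].

Definition unisolvent (R : realType) (k : nat) (T : cuboid R) : Prop :=
  forall B : dof_kind -> entity -> seq ('rV[R]_3 -> R),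
    (forall g E, g \in dof_kinds k -> is_basis (@Qpoly R (dof_tests g)) (B g E)) ->
    is_basis (dual (S := @Sigma R k)) (dofs k T B).

(** * Domains and meshes *)

Definition contractible (R : realType) (Omega : set 'rV[R]_3) : Prop :=
  exists (x0 : 'rV[R]_3) (H : 'rV[R]_3 * R -> 'rV[R]_3),
    [/\ Omega x0,
        {within Omega `*` `[0, 1], continuous H},
        forall x t, Omega x -> 0 <= t <= 1 -> Omega (H (x, t)),
        forall x, Omega x -> H (x, 0) = x
      & forall x, Omega x -> H (x, 1) = x0].

(* Near every boundary point [x0], in Cartesian coordinates y centred at [x0],
   [Omega] is the set of points above the graph of a Lipschitz function. *)
Definition lipschitz_boundary (R : realType) (Omega : set 'rV[R]_3) : Prop :=
  forall x0, (closure Omega `\` interior Omega) x0 ->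
  exists (A : 'M[R]_3) (r h : R) (gam : 'rV[R]_2 -> R),
    [/\ A *m A^T = 1%:M, 0 < r, 0 < h, lipschitz gam
      & forall y : 'rV[R]_3,
          `|y 0 0| < r -> `|y 0 1| < r ->
          let gy := gam (\row_(i < 2) y 0 (widen_ord (leqnSn 2) i)) in
          `|gy| <= h / 2 /\
          (`|y 0 2%:R| < h -> (Omega (x0 + y *m A) <-> gy < y 0 2%:R))].

(* [Th] is a face-to-face partition of [Omega]: two distinct cells are disjoint
   or meet in a common vertex, edge or face. *)
Definition is_mesh (R : realType) (Omega : set 'rV[R]_3) (Th : set (cuboid R)) :=
  [/\ finite_set Th,
      closure Omega = \bigcup_(T in Th) cell T,
      forall T, Th T -> open_cell T `<=` Omega
    & forall T T', Th T -> Th T' -> T <> T' ->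
        cell T `&` cell T' !=set0 ->
        exists E E' : entity,
          [/\ E <> cell_entity, E' <> cell_entity,
              cell T `&` cell T' = points T E
            & cell T `&` cell T' = points T' E']].

(* Fields are considered up to null sets, so a field is prescribed on the open
   cells only: [P T] is its restriction to the cell [T], and need not agree with
   that to a neighbouring cell on the interface. *)
Definition fe_space (R : realType) (k : nat) (Th : set (cuboid R)) :
    set ('rV[R]_3 -> 'M[R]_3) :=
  [set s | exists P : cuboid R -> 'rV[R]_3 -> 'M[R]_3,
    [/\ forall T, Th T -> @Sigma R k (P T),
        forall T, Th T -> forall x, open_cell T x -> s x = P T x
      & forall T T' (E E' : entity), Th T -> Th T' ->
          E <> cell_entity -> E' <> cell_entity ->
          points T E = points T' E' ->
          forall g, g \in dof_kinds k -> spans E (unzip1 (dof_tests g)) ->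
          forall p, (if nilp (dof_tests g) then p = cst 1
                     else @Qpoly R (dof_tests g) p) ->
          dof T g E p (P T) = dof T' g E' p (P T')]].

(** * The space H(curl, Omega; S) *)

(* Lebesgue measure on R^3 is the product measure on R * R * R, carried to row
   vectors by [pt]. *)
Definition pt (R : realType) (w : R * R * R) : 'rV[R]_3 :=
  \row_i nth 0 [:: w.1.1; w.1.2; w.2] i.

Definition leb2 (R : realType) :=
  (@lebesgue_measure R \x @lebesgue_measure R)%E.
HB.instance Definition _ R := Measure.on (@leb2 R).

Lemma leb2_sigma_finite (R : realType) : sigma_finite setT (@leb2 R).
Proof.
have /sigma_finiteP[F [TF ndF Foo]] := sigma_finiteT (@lebesgue_measure R).
exists (fun n => F n `*` F n).
  rewrite -setXTT TF predeqE => -[x y]; split=> [[/= [n _ Fnx] [k _ Fky]]|].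
    exists (maxn n k) => //; split.
    - by move: x Fnx; exact/subsetPset/ndF/leq_maxl.
    - by move: y Fky; exact/subsetPset/ndF/leq_maxr.
  by move=> [n _ []/= ? ?]; split; exists n.
move=> k; have [mF Fk] := Foo k; split; first exact: measurableX.
by rewrite /leb2 product_measure1E// lte_mul_pinfty// ge0_fin_numE.
Qed.

HB.instance Definition _ R :=
  Measure_isSigmaFinite.Build _ _ _ (@leb2 R) (@leb2_sigma_finite R).

Definition leb3 (R : realType) := (@leb2 R \x @lebesgue_measure R)%E.
HB.instance Definition _ R := Measure.on (@leb3 R).

Definition L2 (R : realType) (Omega : set 'rV[R]_3) (f : 'rV[R]_3 -> R) : Prop :=
  ((\1_Omega \* f) \o @pt R) \in Lfun (@leb3 R) 2%:E.

Definition smooth (R : realType) (f : 'rV[R]_3 -> R) : Prop :=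
  forall s : seq 'I_3,
    let g := foldr (@partial R) f s in
    continuous g /\ forall x i, derivable g x (delta_mx 0 i).

(* C_c^infty(Omega), the functions being extended by zero to R^3. *)
Definition test_function (R : realType) (Omega : set 'rV[R]_3)
    (phi : 'rV[R]_3 -> R) : Prop :=
  smooth phi /\
  exists K, [/\ compact K, K `<=` Omega & forall x, ~ K x -> phi x = 0].

(* [w] is the row-wise distributional curl of [v] in [Omega]. As
   (curl u)_m = d_(m+1) u_(m+2) - d_(m+2) u_(m+1), indices modulo 3, integration
   by parts moves the derivatives to the test function. The integrands vanish
   outside of [Omega]. *)
Definition weak_curl (R : realType) (Omega : set 'rV[R]_3)
    (v w : 'rV[R]_3 -> 'M[R]_3) : Prop :=
  forall phi, test_function Omega phi -> forall r m : 'I_3,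
    \int[@leb3 R]_z (w (pt z) r m * phi (pt z)) =
    \int[@leb3 R]_z (v (pt z) r (m + 1) * partial (m + 2%:R) phi (pt z)
                     - v (pt z) r (m + 2%:R) * partial (m + 1) phi (pt z)).

(* All the fields that agree almost everywhere in [Omega] with a Borel
   measurable representative [u]. *)
Definition Hcurl (R : realType) (Omega : set 'rV[R]_3) :
    set ('rV[R]_3 -> 'M[R]_3) :=
  [set v | exists u : 'rV[R]_3 -> 'M[R]_3,
    [/\ {ae @leb3 R, forall z, Omega (pt z) -> v (pt z) = u (pt z)},
        forall i j, L2 Omega (fun x => u x i j),
        forall x, Omega x -> (u x)^T = u x
      & exists w : 'rV[R]_3 -> 'M[R]_3,
          (forall i j, L2 Omega (fun x => w x i j)) /\ weak_curl Omega u w]].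

(* Main.v *)
Require Import Defs.
From HB Require Import structures.
From mathcomp Require Import all_boot all_order all_algebra.
From mathcomp Require Import all_classical all_reals all_analysis.
From mathcomp Require Import measurable_realfun.
From mathcomp Require Import zify ring lra.
From mathcomp Require Import (canonicals, coercions) mpoly.

Set Implicit Arguments.
Unset Strict Implicit.
Unset Printing Implicit Defensive.

Import Order.TTheory GRing.Theory Num.Theory.
Import numFieldNormedType.Exports.

Local Open Scope classical_set_scope.
Local Open Scope ring_scope.

(** On each entry of the tensor every degree of freedom is a product of three
    functionals of one variable: the value or the derivative at an end point, or
    the moment against a monomial. Unisolvence is then obtained one variable at
    a time. A polynomial in one variable of degree less than N + 2e is zero if
    its derivatives of order less than e vanish at both end points and its
    moments against the degrees less than N vanish: it is w r with w of constant
    sign on the interval and r of degree less than N, so that the integral of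
    w r^2 is zero. Only the degrees of freedom in x_l depend on the kind of
    functional in x_i and x_j. As the degrees of freedom separate the fields and
    are as many as the dimension, they form a basis of the dual space.

    The same argument with one variable frozen shows that the degrees of freedom
    on a face with normal x_n and on its boundary determine the traces of all
    the entries except the (n, n) one. Hence, on each line in the direction x_n
    inside the domain, these entries are continuous and piecewise polynomial, so
    that they can be integrated by parts without boundary terms; by Fubini's
    theorem the curl taken cell by cell is the distributional curl. *)

(** * Linear forms on polynomials in three variables *)

(** Everything rests on splitting the number of powers of one variable as N + 2e. For sigma_ii it is
    k - 1 = (k - 1) + 0 in x_i and k + 1 = (k - 1) + 2 in the other variables. For sigma_ij it is k
    = (k - 2) + 2 in x_i and in x_j, and in x_l either k + 1 = (k - 3) + 4 or k + 1 = (k - 1) + 2.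
    The former needs k >= 3, the latter is used exactly on F_ij and on T; so the degrees of freedom
    are not a tensor product, and x_l has to be treated last. The case e = 0 is also why sigma_nn
    has no trace on a face with normal x_n: no functional sees its values at the ends in x_n. The
    curl never differentiates column n in the direction x_n, so this jump does no harm. Polynomials
    are paired with products of arbitrary linear forms in one variable. Evaluation, integration and
    extraction of a coefficient are then treated alike, and one lemma serves both unisolvence and
    traces. *)

Notation mon := (mpoly.multinom 3).
Notation mpoly3 R := (mpoly.mpoly 3 R).
Notation "'X^{ m }" := (mpoly.mpolyX _ m) (at level 0, format "''X^{' m }").

Section LinearForms.
Variable R : realType.
Implicit Types (G : mon -> R) (p q : mpoly3 R) (m : mon).

Definition mlin G p : R := \sum_(m <- mpoly.msupp p) mpoly.mcoeff m p * G m.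

Lemma mlin_widen G p (s : seq mon) : uniq s -> {subset mpoly.msupp p <= s} ->
  mlin G p = \sum_(m <- s) mpoly.mcoeff m p * G m.
Proof.
move=> us ps; rewrite (bigID (mem (mpoly.msupp p)))/= [X in _ + X]big1 ?addr0.
  rewrite -big_filter; apply: perm_big; apply: uniq_perm.
  - exact: mpoly.msupp_uniq.
  - exact: filter_uniq.
  - by move=> m; rewrite mem_filter; case: (boolP (m \in _)) => // /ps ->.
by move=> m /mpoly.memN_msupp_eq0 ->; rewrite mul0r.
Qed.

Lemma mlin_is_linear G : scalar (mlin G).
Proof.
move=> a p q /=.
pose s := undup (mpoly.msupp (a *: p + q) ++ mpoly.msupp p ++ mpoly.msupp q).
rewrite !(@mlin_widen _ _ s) ?undup_uniq// => [|m|m|m]; last 3 first.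
  by rewrite mem_undup !mem_cat => ->; rewrite !orbT.
  by rewrite mem_undup !mem_cat => ->; rewrite !orbT.
  by rewrite mem_undup !mem_cat => ->.
rewrite mulr_sumr -big_split; apply: eq_bigr => m _ /=.
by rewrite mpoly.mcoeffD mpoly.mcoeffZ mulrDl mulrA.
Qed.

HB.instance Definition _ G :=
  GRing.isLinear.Build R (mpoly3 R) R *%R (mlin G) (mlin_is_linear G).

Lemma mlinX G m : mlin G 'X^{m} = G m.
Proof.
by rewrite /mlin mpoly.msuppX big_seq1 mpoly.mcoeffX eqxx mul1r.
Qed.

Lemma eq_mlin G1 G2 p : {in mpoly.msupp p, G1 =1 G2} -> mlin G1 p = mlin G2 p.
Proof. by move=> e; apply: eq_big_seq => m mp; rewrite e. Qed.

Lemma mlinMX G p m : mlin G (p * 'X^{m}) = mlin (fun m' => G (mpoly.mnm_add m' m)) p.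
Proof.
rewrite {1}[p]mpoly.mpolyE mulr_suml linear_sum /mlin; apply: eq_bigr => m' _.
by rewrite -scalerAl linearZ/= -mpoly.mpolyXD mlinX.
Qed.

Lemma mlin_mderiv G p i :
  mlin G (mpoly.mderiv i p) =
  mlin (fun m => (m i)%:R * G (mpoly.mnm_sub m (mpoly.mnm1 i))) p.
Proof.
rewrite {1}[p]mpoly.mpolyE.

rewrite (raddf_sum (mpoly.mderiv i)) linear_sum /mlin /=; apply: eq_bigr => m _.
by rewrite mpoly.mderivZ linearZ/= mpoly.mderivX linearZ/= mlinX.
Qed.

(** The tensor product of three linear forms in one variable, [L i a] being the value of the i-th
    one at the a-th power. *)
Definition tens (L : 'I_3 -> nat -> R) := mlin (fun m => \prod_i L i (m i)).

HB.instance Definition _ L := GRing.Linear.on (tens L).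

Lemma meval_tens (x : 'I_3 -> R) p :
  mpoly.meval x p = tens (fun i a => x i ^+ a) p.
Proof. by rewrite mpoly.mevalE. Qed.

Lemma eq_tens L1 L2 p : (forall i, L1 i =1 L2 i) -> tens L1 p = tens L2 p.
Proof. by move=> e; apply: eq_mlin => m _; apply: eq_bigr => i _; rewrite e. Qed.

Lemma tensMX L p m : tens L (p * 'X^{m}) = tens (fun i a => L i (a + m i)%N) p.
Proof.
rewrite /tens mlinMX; apply: eq_mlin => m' _; apply: eq_bigr => i _.
by rewrite mpoly.mnmDE.
Qed.

Definition upd (L : 'I_3 -> nat -> R) i w := fun j => if j == i then w else L j.

Lemma tens_mderiv L p i :
  tens L (mpoly.mderiv i p) =
  tens (upd L i (fun a => a%:R * L i a.-1)) p.
Proof.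
rewrite /tens mlin_mderiv; apply: eq_mlin => m _; rewrite /upd.
rewrite (bigD1 i)//= [RHS](bigD1 i)//= eqxx mulrA; congr (_ * _ * _).
  by rewrite mpoly.mnmBE mpoly.mnm1E eqxx subn1.
apply: eq_bigr => j ji; rewrite mpoly.mnmBE mpoly.mnm1E eq_sym (negbTE ji).
by rewrite subn0.
Qed.

(** The forms b -> [b = a] read off the coefficient of x_i^a, so the i-th factor is expanded in the
    dual basis of the powers of x_i. The other factors contract [p] to the coefficients of a
    polynomial in x_i. *)
Lemma tens_updE L p i w d :
  (forall m, m \in mpoly.msupp p -> (m i < d)%N) ->
  tens (upd L i w) p =
  \sum_(a < d) tens (upd L i (fun b => (b == a)%:R)) p * w a.
Proof.
move=> hd; rewrite /tens /mlin.
under [RHS]eq_bigr do rewrite mulr_suml.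
rewrite exchange_big/=; apply: eq_big_seq => m mp.
rewrite (bigD1 i)//= {1}/upd eqxx.
have e a w' : \prod_(j < 3 | j != i) upd L i w' j (m j) =
              \prod_(j < 3 | j != i) upd L i a j (m j).
  by apply: eq_bigr => j /negbTE; rewrite /upd => ->.
rewrite (bigD1 (Ordinal (hd _ mp)))//= [X in _ = _ + X]big1 => [|a /negP ami].
  rewrite addr0 [X in _ = _ * X * _](bigD1 i)//= {2}/upd eqxx eqxx mul1r.
  by rewrite (e w (fun b => (b == m i)%:R)) mulrCA mulrC.
rewrite (bigD1 i)//= {1}/upd eqxx; case: eqP => [ma|_]; last by rewrite mul0r mulr0 mul0r.
by case: ami; apply/eqP/val_inj.
Qed.

End LinearForms.

(** * Moments and endpoint values in one variable *)

Section OneVariable.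
Variable R : realType.
Implicit Types (p q : {poly R}) (a b : R).

Definition pint a b p : R :=
  \int[@lebesgue_measure R]_(t in `[a, b]) p.[t].

Lemma integrable_horner a b p :
  (@lebesgue_measure R).-integrable `[a, b] (EFin \o horner p).
Proof.
apply: continuous_compact_integrable; first exact: segment_compact.
exact/continuous_subspaceT/continuous_horner.
Qed.

Lemma pint_is_linear a b : scalar (pint a b).
Proof.
move=> c p q; rewrite /pint.
under eq_Rintegral do rewrite hornerD hornerZ.
rewrite RintegralD//; last exact: integrable_horner.
  by rewrite RintegralZl//; exact: integrable_horner.
have /= := @integrable_horner a b (c *: p).
by congr (_.-integrable _ _); apply/funext => t /=; rewrite hornerZ.
Qed.

HB.instance Definition _ a b :=
  GRing.isLinear.Build R {poly R} R *%R (pint a b) (pint_is_linear a b).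

Lemma finite_roots p : p != 0 -> finite_set [set t | root p t].
Proof.
have [n] := ubnP (size p); elim: n p => // n IH p pn p0.
have [[c rc]|nr] := pselect (exists c, root p c); last first.
  rewrite (_ : [set _ | _] = set0)//; apply/seteqP; split=> // t rt.
  by apply: nr; exists t.
have /factor_theorem[q pq] := rc.
have q0 : q != 0 by apply: contraNneq p0 => q0; rewrite pq q0 mul0r.
apply: (@sub_finite_set _ _ ([set c] `|` [set t | root q t])).
  by move=> t /=; rewrite pq rootM root_XsubC => /orP[->|/eqP ->]; [right|left].
rewrite finite_setU; split=> //; apply: IH => //.
by move: pn; rewrite pq size_Mmonic ?monicXsubC// size_XsubC addn2.
Qed.

(** The integrand vanishes almost everywhere on the interval, yet a nonzero polynomial has finitely
    many roots; the interval would be covered by two null sets. *)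
Lemma pint_eq0 a b p : a < b -> (forall t, a <= t <= b -> 0 <= p.[t]) ->
  pint a b p = 0 -> p = 0.
Proof.
move=> ab p0 ip; apply/eqP; apply: contrapT => /negP pn0.
have mp := measurable_int _ (integrable_horner a b p).
have : (\int[@lebesgue_measure R]_(x in `[a, b]) `|(EFin \o horner p) x| = 0)%E.
  rewrite -[RHS]/(0%:E) -ip /pint /Rintegral fineK; last first.
    by apply: integrable_fin_num => //; exact: integrable_horner.
  apply: eq_integral => x; rewrite inE/= in_itv/= => /p0 px.
  by rewrite ger0_norm.
move=> i0; have [N [mN N0 pN]] :=
  iffLR (ae_eq_integral_abs (@lebesgue_measure R) (measurable_itv _) mp) i0.
have := @countable_lebesgue_measure0 R _ (finite_set_countable (finite_roots pn0)).
set Z := [set t | _] => Z0.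
have mZ : measurable Z.
  apply: countable_measurable (finite_set_countable (finite_roots pn0)) => t.
  exact: measurable_set1.
have : ((@lebesgue_measure R) `[a, b]%classic <= 0)%E.
  rewrite -(_ : lebesgue_measure (N `|` Z) = 0%E).
    apply: le_measure; rewrite ?inE//; first exact: measurableU.
    move=> t tab; have [/eqP r|r] := eqVneq p.[t] 0; first by right.
    by left; apply: pN => /= /(_ tab) [] e; rewrite e eqxx in r.
  apply/eqP; rewrite -measure_le0; apply: (le_trans (measureU2 _ mN mZ)).
  by rewrite [X in (X + _)%E]N0 [X in (_ + X)%E]Z0 adde0.
rewrite lebesgue_measure_itv/= lte_fin ab -EFinB lee_fin subr_le0.
by rewrite leNgt ab.
Qed.

End OneVariable.

(** * The functionals in one variable *)

(* [Ev c] and [Der c] are the value and the derivative at the lower ([c = false])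
   or upper end point of an interval, [Mom n] is the moment against x^n. *)
Inductive fn := Ev of bool | Der of bool | Mom of nat.

(** [e] is the number of data at each end point (none, the value, or the value and the derivative),
    and [N] is the number of moments. *)
Definition fnb (e N : nat) (q : fn) : bool :=
  match q with Ev _ => (0 < e)%N | Der _ => (1 < e)%N | Mom n => (n < N)%N end.

Section Functionals.
Variables (R : realType) (a b : R).
Hypothesis ab : a < b.
Implicit Types (p r w : {poly R}) (q : fn).

Definition fpoly q p : R :=
  match q with
  | Ev c => p.[if c then b else a]
  | Der c => p^`().[if c then b else a]
  | Mom n => pint a b (p * 'X^n)
  end.

Lemma fpoly_is_linear q : scalar (fpoly q).
Proof.
move=> c p r; case: q => [e|e|n] /=.
- by rewrite hornerD hornerZ.
- by rewrite linearP/= hornerD hornerZ.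
- by rewrite mulrDl -scalerAl linearP.
Qed.

HB.instance Definition _ q :=
  GRing.isLinear.Build R {poly R} R *%R (fpoly q) (fpoly_is_linear q).

Definition fval q (j : nat) : R := fpoly q 'X^j.

Lemma fpoly_fval d q p : (size p <= d)%N ->
  fpoly q p = \sum_(j < d) p`_j * fval q j.
Proof.
move=> pd; have -> : p = \poly_(j < d) p`_j.
  apply/polyP => j; rewrite coef_poly; case: ltnP => // dj.
  by rewrite nth_default// (leq_trans pd).
rewrite {1}poly_def linear_sum; apply: eq_bigr => j _.
by rewrite linearZ/= coef_poly ltn_ord.
Qed.

(* The weight [w] is nonnegative, so test [r] against itself. *)
Lemma moments_eq0 w r N : (forall t, a <= t <= b -> 0 <= w.[t]) ->
  (size r <= N)%N -> (forall n, (n < N)%N -> pint a b (w * r * 'X^n) = 0) ->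
  w * r = 0.
Proof.
move=> w0 rN h; suff /eqP : w * (r * r) = 0.
  by rewrite !mulf_eq0 orbb -mulf_eq0 => /eqP.
apply: (pint_eq0 ab) => [t tab|].
  by rewrite hornerM mulr_ge0 ?w0// hornerM -expr2 sqr_ge0.
rewrite mulrA -[X in _ * X]coefK poly_def mulr_sumr linear_sum big1// => i _.
by rewrite -scalerAr linearZ/= h ?mulr0// (leq_trans _ rN).
Qed.

Lemma fpoly_sep e N p : (e <= 2)%N -> (size p <= N + e.*2)%N ->
  (forall q, fnb e N q -> fpoly q p = 0) -> p = 0.
Proof.
move=> e2 sp h.
have hM n : (n < N)%N -> pint a b (p * 'X^n) = 0 by exact: (h (Mom n)).
have ba : b - a != 0 by rewrite subr_eq0 gt_eqF.
have szF (c : R) r n : (size (r * ('X - c%:P))%R <= n.+1)%N -> (size r <= n)%N.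
  have [->|r0] := eqVneq r 0; first by rewrite size_poly0.
  by rewrite size_Mmonic ?monicXsubC// size_XsubC addn2.
case: e e2 sp h => [|[|[|//]]] _ sp h.
- rewrite -[p]mul1r; apply: (@moments_eq0 _ _ N) => [t _||n nN].
  + by rewrite hornerE ler01.
  + by rewrite addn0 in sp.
  + by rewrite mul1r hM.
- have /factor_theorem[q pq] : root p a by apply/eqP/(h (Ev false)).
  have /factor_theorem[r qr] : root q b.
    have := h (Ev true) isT; rewrite /= pq !hornerE => /eqP.
    by rewrite mulf_eq0 (negbTE ba) orbF.
  (* The factor b - X makes the weight nonnegative on the interval; the sign goes to the
     cofactor. *)
  have e : p = (('X - a%:P) * (b%:P - 'X)) * (- r).
    by rewrite pq qr; ring.
  rewrite e; apply: (@moments_eq0 _ _ N) => [t /andP[at_ tb]||n nN].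
  + by rewrite !hornerE mulr_ge0// subr_ge0.
  + rewrite size_polyN; apply: (szF b); rewrite -qr; apply: (szF a).
    by rewrite -pq (leq_trans sp)// addn2.
  + by rewrite -e hM.
- have /factor_theorem[q pq] : root p a by apply/eqP/(h (Ev false)).
  have /factor_theorem[r qr] : root q b.
    have := h (Ev true) isT; rewrite /= pq !hornerE => /eqP.
    by rewrite mulf_eq0 (negbTE ba) orbF.
  (* At an end point only one of the terms with r itself survives, so r vanishes there as well. *)
  have dp : p^`() = r^`() * (('X - a%:P) * ('X - b%:P))
      + r * ('X - a%:P) + r * ('X - b%:P).
    by rewrite pq qr !derivM !derivXsubC; ring.
  have /factor_theorem[s rs] : root r a.
    have := h (Der false) isT; rewrite /= dp !(hornerXsubC, hornerD, hornerM) => /eqP.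
    rewrite subrr !(mul0r, mulr0, add0r) mulf_eq0 => /orP[//|].
    by rewrite -opprB oppr_eq0 (negbTE ba).
  have /factor_theorem[u su] : root s b.
    have := h (Der true) isT; rewrite /= dp {2 3}rs !(hornerXsubC, hornerD, hornerM) => /eqP.
    by rewrite subrr !(mulr0, add0r, addr0) !mulf_eq0 (negbTE ba) !orbF.
  have e : p = (('X - a%:P) * ('X - b%:P)) ^+ 2 * u.
    by rewrite pq qr rs su; ring.
  rewrite e; apply: (@moments_eq0 _ _ N) => [t _||n nN].
  + by rewrite !hornerE sqr_ge0.
  + apply: (szF b); rewrite -su; apply: (szF a); rewrite -rs.
    apply: (szF b); rewrite -qr; apply: (szF a).
    by rewrite -pq (leq_trans sp)// addn4.
  + by rewrite -e hM.
Qed.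

(* The forms in [W'], on the polynomials of degree less than [d], are linear
   combinations of the functionals in [W]. *)
Definition forms_span d (W : pred fn) (W' : set (nat -> R)) :=
  forall p, (size p <= d)%N -> (forall q, W q -> fpoly q p = 0) ->
  forall v : nat -> R, W' v -> \sum_(j < d) p`_j * v j = 0.

Lemma forms_span_fnb e N d : (e <= 2)%N -> d = (N + e.*2)%N ->
  forms_span d (fnb e N) setT.
Proof.
move=> e2 -> p sp h w _; rewrite (fpoly_sep e2 sp h).
by rewrite big1// => j _; rewrite coef0 mul0r.
Qed.

Lemma forms_span_ev d c (W : pred fn) : W (Ev c) ->
  forms_span d W [set fval (Ev c)].
Proof. by move=> Wc p sp h w ->; rewrite -fpoly_fval ?h. Qed.

End Functionals.

Lemma mem_uniq3 (i j l m : 'I_3) : uniq [:: i; j; l] -> m \in [:: i; j; l].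
Proof.
move=> u; have [x _||_ ->] := uniq_min_size u (s2 := enum 'I_3).
- by rewrite mem_enum.
- by rewrite size_enum_ord.
- by rewrite mem_enum.
Qed.

(** * Treating a form in three variables one variable at a time *)

Section Peeling.
Variables (R : realType) (lo hi : 'I_3 -> R) (p : mpoly3 R) (d : 'I_3 -> nat).
Hypothesis hd : forall m, m \in mpoly.msupp p -> forall i, (m i < d i)%N.

(** With the other two factors fixed, the form is the pairing of [L i] with the coefficients of a
    polynomial in x_i. The functionals in [W] kill this polynomial, hence so do the forms in
    [W']. *)
Lemma tens_peel i W W' (L : 'I_3 -> nat -> R) :
  forms_span (lo i) (hi i) (d i) W W' ->
  (forall q, W q -> tens (upd L i (fval (lo i) (hi i) q)) p = 0) ->
  W' (L i) -> tens L p = 0.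
Proof.
move=> sp h w'; rewrite (@eq_tens _ _ (upd L i (L i))); last first.
  by move=> j ?; rewrite /upd; case: eqP => // ->.
rewrite (tens_updE L (L i) (fun m mp => hd mp i)).
pose c k := tens (upd L i (fun b => (b == k)%:R)) p.
have e : forall w : nat -> R, \sum_(k < d i) (\poly_(k < d i) c k)`_k * w k =
    \sum_(k < d i) c k * w k.
  by move=> w; apply: eq_bigr => k _; rewrite coef_poly ltn_ord.
rewrite -[LHS]e; apply: (sp _ (size_poly _ _)) => // q Wq.
rewrite (fpoly_fval _ _ _ (size_poly _ _)) e -[LHS]tens_updE ?h//.
by move=> m mp; apply: hd.
Qed.

(** [Wl] takes the functionals chosen in x_i and x_j as arguments, so x_l is peeled last, when both
    are known. *)
Lemma tens_vanish i j l (Wi Wj : pred fn) (Wl : fn -> fn -> pred fn)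
    (W' : 'I_3 -> set (nat -> R)) :
  uniq [:: i; j; l] ->
  forms_span (lo i) (hi i) (d i) Wi (W' i) ->
  forms_span (lo j) (hi j) (d j) Wj (W' j) ->
  (forall qi qj, Wi qi -> Wj qj ->
     forms_span (lo l) (hi l) (d l) (Wl qi qj) (W' l)) ->
  (forall q : 'I_3 -> fn, Wi (q i) -> Wj (q j) -> Wl (q i) (q j) (q l) ->
     tens (fun m => fval (lo m) (hi m) (q m)) p = 0) ->
  forall L, (forall m, W' m (L m)) -> tens L p = 0.
Proof.
move=> /=; rewrite !inE !negb_or andbT => /andP[/andP[ij il] jl].
move=> si sj sl h L hL.
have [ji li lj] : [/\ j == i = false, l == i = false & l == j = false].
  by split; apply/negbTE; rewrite eq_sym.
apply: (tens_peel si) => // qi Wqi.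
apply: (tens_peel sj) => [qj Wqj|]; last by rewrite /upd ji.
apply: (tens_peel (sl _ _ Wqi Wqj)) => [ql Wql|]; last by rewrite /upd lj li.
pose q m := if m == i then qi else if m == j then qj else ql.
rewrite -(h q); rewrite /q ?eqxx ?ji ?li ?lj//.
apply: eq_tens => m n; rewrite /upd.
have : m \in [:: i; j; l].
  by apply: mem_uniq3; rewrite /= !inE negb_or ij il jl.
rewrite !inE; case: (eqVneq m l) => [->|ml]; rewrite ?li ?lj// orbF.
by move=> /orP[]/eqP ->; rewrite ?eqxx ?ji ?ij// (negbTE ij).
Qed.

End Peeling.

(** * Degrees of freedom of polynomial fields *)

Lemma mpoly_ring_ind (R : realType) (D : mpoly3 R -> Prop) :
  (forall c, D (mpoly.mpolyC 3 c)) ->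
  (forall p q, D p -> D q -> D (p + q)) ->
  (forall p q, D p -> D q -> D (p * q)) ->
  (forall i, D 'X^{mpoly.mnm1 i}) -> forall p, D p.
Proof.
move=> DC DD DM DX p.
elim/mpoly.mpolyind: p => [|c m q _ _ Dq].
  by rewrite -(mpoly.mpolyC0 3 R); exact: DC.
apply: (DD _ _ _ Dq); rewrite -mpoly.mul_mpolyC; apply: (DM) => //.
rewrite mpoly.mpolyXE_id; apply: (big_ind D) => [||i _].
- by rewrite -mpoly.mpolyC1; exact: DC.
- exact: DM.
- elim: (m i) => [|n IH]; last by rewrite exprS; exact: DM.
  by rewrite expr0 -mpoly.mpolyC1; exact: DC.
Qed.

Section EntityForms.
Variable R : realType.
Implicit Types (p : mpoly3 R) (T : cuboid R) (E : entity).

Definition mfun p : 'rV[R]_3 -> R := fun x => mpoly.meval (x 0) p.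

Lemma is_derive_coord (x v : 'rV[R]_3) i :
  is_derive x v (fun y : 'rV[R]_3 => y 0 i) (v 0 i).
Proof.
have h : (fun t : R =>
    t^-1 *: (((fun y : 'rV[R]_3 => y 0 i) \o shift x) (t *: v) - x 0 i))
   @ 0^' --> v 0 i.
  apply: cvg_near_cst; near=> t; rewrite /= !mxE addrK scalerA mulVf ?scale1r//.
  by near: t; exact: nbhs_dnbhs_neq.
split; first by apply/cvg_ex; exists (v 0 i).
exact: cvg_lim.
Unshelve. all: by end_near. Qed.

Lemma is_derive_mfun p (x : 'rV[R]_3) i :
  is_derive x (delta_mx 0 i) (mfun p) (mfun (mpoly.mderiv i p) x).
Proof.
pose D q := is_derive x (delta_mx 0 i) (mfun q) (mfun (mpoly.mderiv i q) x).
have DC c : D (mpoly.mpolyC 3 c).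
  rewrite /D mpoly.mderivC /mfun mpoly.meval0.
  rewrite (_ : (fun _ => _) = cst c); first exact: is_derive_cst.
  by apply/funext => y; rewrite mpoly.mevalC.
have DD q r : D q -> D r -> D (q + r).
  rewrite /D => hq hr; rewrite linearD/= /mfun mpoly.mevalD.
  rewrite (_ : (fun _ => _) = mfun q + mfun r); first exact: is_deriveD.
  by apply/funext => y; rewrite mpoly.mevalD.
have DM q r : D q -> D r -> D (q * r).
  rewrite /D => hq hr.
  rewrite (_ : mfun (q * r) = mfun q * mfun r); last first.
    by apply/funext => y; rewrite /mfun mpoly.mevalM.
  apply: is_derive_eq; rewrite mpoly.mderivM /mfun mpoly.mevalD !mpoly.mevalM.
  by rewrite addrC /GRing.scale/=; congr (_ + _); exact: mulrC.
have DX j : D 'X^{mpoly.mnm1 j}.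
  rewrite /D mpoly.mderivX.
  rewrite (_ : mfun _ = fun y => y 0 j); last first.
    by apply/funext => y; rewrite /mfun mpoly.mevalXU.
  apply: is_derive_eq; first exact: is_derive_coord.
  rewrite mxE eqxx/= /mfun mpoly.mevalZ mpoly.mnm1E.
  case: (eqVneq j i) => [->|_]; last by rewrite mul0r.
  rewrite mul1r mpoly.mevalX big1// => l _.
  by rewrite mpoly.mnmBE subnn expr0.
exact: (mpoly_ring_ind DC DD DM DX).
Qed.

Lemma partial_mfun i p : partial i (mfun p) = mfun (mpoly.mderiv i p).
Proof. by apply/funext => x; have [] := is_derive_mfun p x i. Qed.

Definition ent_form T E (i : 'I_3) (e : nat) : R :=
  if E i is Some c then bound T c i ^+ e else pint (lo T 0 i) (hi T 0 i) 'X^e.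

(** [S] lists the directions already integrated: there the factors in which [E] extends have become
    moments, while all the others are still powers of the coordinates. *)
Let phi T E (S : seq 'I_3) j e (t : R) : R :=
  if (j \in S) && (E j == None) then pint (lo T 0 j) (hi T 0 j) 'X^e else t ^+ e.

Let int_dir_tens T E i S p : i \notin S ->
  int_dir T E i (fun x => tens (fun j e => phi T E S j e (x 0 j)) p) =
  fun x => tens (fun j e => phi T E (i :: S) j e (x 0 j)) p.
Proof.
move=> iS; apply/funext => x; rewrite /int_dir.
case Ei : (E i) => [c|].
  apply: eq_tens => j e; rewrite /phi inE.
  by case: (eqVneq j i) => //= ->; rewrite Ei andbF.
set L := fun j e => phi T E S j e (x 0 j).
(* Any bound on the degree in x_i will do; the total degree gives one. *)
have hd m : m \in mpoly.msupp p -> (m i < mpoly.mmeasure mpoly.mdeg p)%N.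
  move=> /mpoly.msize_mdeg_lt; apply: leq_ltn_trans.
  by rewrite mpoly.mdegE (bigD1 i)//= leq_addr.
under eq_Rintegral => t _.
  rewrite (_ : tens _ p = tens (upd L i (fun e => t ^+ e)) p); last first.
    apply: eq_tens => j e; rewrite /upd /L /phi mxE.
    by case: (eqVneq j i) => // ->; rewrite (negbTE iS).
  rewrite (tens_updE _ _ hd).
  rewrite -(horner_poly _ (fun k => tens (upd L i (fun b => (b == k)%:R)) p)).
  over.
rewrite -[LHS]/(pint _ _ _) poly_def linear_sum.
under eq_bigr do rewrite linearZ/=.
rewrite -(tens_updE L (fun e => pint _ _ 'X^e) hd); apply: eq_tens => j e.
rewrite /upd /L /phi inE; case: (eqVneq j i) => [->|//].
by rewrite Ei eqxx.
Qed.

Lemma int_entity_mfun T E p : int_entity T E (mfun p) = tens (ent_form T E) p.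
Proof.
rewrite /int_entity (_ : mfun p = fun x => tens (fun j e => phi T E [::] j e (x 0 j)) p).
  rewrite !int_dir_tens//; apply: eq_tens => i e.
  rewrite /phi /ent_form !mxE; have -> : i \in [:: 0; 1; 2%:R] by apply: mem_uniq3.
  by case: (E i).
by apply/funext => x; rewrite /mfun meval_tens.
Qed.

Lemma dofE T g E (p q : mpoly3 R) (s : 'rV[R]_3 -> 'M[R]_3) :
  (fun x => s x (dof_row g) (dof_col g)) = mfun p ->
  dof T g E (mfun q) s =
  tens (ent_form T E) ((if dof_der g is Some l then mpoly.mderiv l p else p) * q).
Proof.
rewrite /dof => ->; rewrite -int_entity_mfun.
congr int_entity; apply/funext => x.
by case: (dof_der g) => [l|]; rewrite ?partial_mfun /mfun mpoly.mevalM.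
Qed.

(** One functional per direction. A code determines an entity, extended in the directions of the
    moments, and a monomial test function of degree zero in the other directions. *)
Definition code := 'I_3 -> fn.

Definition ent_code (q : code) : entity :=
  [ffun i => match q i with Ev c => Some c | Der c => Some c | Mom _ => None end].

Definition mon_code (q : code) : mon :=
  mpoly.Multinom [tuple (if q i is Mom n then n else 0%N) | i < 3].

Definition code_form T (q : code) i := fval (lo T 0 i) (hi T 0 i) (q i).

Lemma mon_codeE q i : mon_code q i = if q i is Mom n then n else 0%N.
Proof. by rewrite mpoly.mnmE. Qed.

(** The derivative in x_l acts on the factor in x_l only, and there the monomial has exponent zero;
    in the directions of integration the monomial shifts the powers. *)
Lemma dof_codeE T g (q : code) p (s : 'rV[R]_3 -> 'M[R]_3) :
  (fun x => s x (dof_row g) (dof_col g)) = mfun p ->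
  (forall i, (if q i is Der _ then true else false) = (dof_der g == Some i)) ->
  dof T g (ent_code q) (mfun 'X^{mon_code q}) s = tens (code_form T q) p.
Proof.
move=> sp qd; rewrite (dofE _ _ _ sp) tensMX.
case: (dof_der g) qd => [l|] qd.
  rewrite tens_mderiv; apply: eq_tens => i e.
  have := qd i; rewrite /upd.
  case: (eqVneq i l) => [->|il]; rewrite /code_form /fval /ent_form ffunE mon_codeE /bound.
    rewrite eqxx; case: (q l) => //= c _.
    by rewrite addn0 derivXn hornerMn hornerXn mulr_natl.
  have -> : (Some l == Some i) = false by apply/negbTE; rewrite eq_sym; exact: il.
  case: (q i) => [c|c|n] //= _; last by rewrite exprD.
  by rewrite addn0 hornerXn.
apply: eq_tens => i e.
have := qd i; rewrite /code_form /fval /ent_form ffunE mon_codeE /bound.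
case: (q i) => [c|c|n] //= _; last by rewrite exprD.
by rewrite addn0 hornerXn.
Qed.

End EntityForms.

(** * The degrees of freedom as products of functionals in one variable *)

Section Codes.
Variables (R : realType) (k : nat).
Hypothesis hk : (3 <= k)%N.
Implicit Types (q : code) (g : dof_kind).

Lemma mem_diag_kinds i g : g \in diag_kinds k i -> g \in dof_kinds k.
Proof.
move=> gi; rewrite mem_cat; apply/orP; left; apply/flatten_mapP.
by exists i => //; rewrite mem_enum.
Qed.

Lemma mem_offdiag_kinds (i j l : 'I_3) g : (i < j)%N -> uniq [:: i; j; l] ->
  g \in offdiag_kinds k i j l -> g \in dof_kinds k.
Proof.
move=> ij u gi; rewrite mem_cat; apply/orP; right; apply/flatten_mapP.
by exists (i, j, l) => //; rewrite mem_filter mem_enum andbT; apply/andP.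
Qed.

Definition is_der (f : fn) := if f is Der _ then true else false.
Definition is_mom (f : fn) := if f is Mom _ then true else false.
Definition mom_deg (f : fn) := if f is Mom n then n else 0%N.

Definition code_for q g : Prop :=
  [/\ forall i, is_der (q i) = (dof_der g == Some i),
      forall i, is_mom (q i) = (i \in unzip1 (dof_tests g))
    & forall i, (mom_deg (q i))%:Z <= deg (dof_tests g) i].

Lemma code_for_spans q g : code_for q g ->
  spans (ent_code q) (unzip1 (dof_tests g)).
Proof.
move=> [_ h _]; apply/forallP => i; rewrite -h ffunE.
by case: (q i).
Qed.

Lemma code_for_test q g : code_for q g ->
  if nilp (dof_tests g) then mfun (R := R) 'X^{mon_code q} = cst 1
  else @Qpoly R (dof_tests g) (mfun 'X^{mon_code q}).
Proof.
move=> [_ h hd]; case: nilP => [e|_].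
  apply/funext => x; rewrite /mfun mpoly.mevalX big1// => i _.
  by rewrite mon_codeE; have := h i; rewrite e; case: (q i).
exists 'X^{mon_code q}; split=> // m; rewrite mpoly.msuppX inE => /eqP -> i.
by rewrite mon_codeE; exact: hd.
Qed.

Lemma deg_cons i (a : int) s m :
  deg ((i, a) :: s) m = (if i == m then a else 0) + deg s m.
Proof. by rewrite /deg big_cons/=; case: ifP => // _; rewrite add0r. Qed.

Lemma deg_nil m : deg [::] m = 0.
Proof. by rewrite /deg big_nil. Qed.

Lemma deg_map (c : int) (s : seq 'I_3) m : uniq s ->
  deg [seq (i, c) | i <- s] m = if m \in s then c else 0.
Proof.
elim: s => [|i s IH] /=; first by rewrite deg_nil.
move=> /andP[ns us]; rewrite deg_cons IH// inE eq_sym.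
by case: eqP => [->|_]; rewrite ?add0r// (negbTE ns) addr0.
Qed.

Lemma forall_uniq3 (i j l : 'I_3) (P : 'I_3 -> Prop) : uniq [:: i; j; l] ->
  P i -> P j -> P l -> forall m, P m.
Proof.
by move=> u Pi Pj Pl m; have := mem_uniq3 m u; rewrite !inE => /or3P[]/eqP ->.
Qed.

Lemma uniq3P (i j l : 'I_3) : uniq [:: i; j; l] ->
  [/\ i == j = false, i == l = false & j == l = false] /\
  [/\ j == i = false, l == i = false & l == j = false].
Proof.
rewrite /= !inE negb_or andbT => /andP[/andP[ij il] jl].
by split; split; apply/negbTE; rewrite // eq_sym.
Qed.

Lemma uniq3_ex (i : 'I_3) : exists j l, uniq [:: i; j; l].
Proof. by exists (i + 1), (i + 2%:R); case: i => -[|[|[|]]]. Qed.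

Definition code_diag i q :=
  fnb 0 (k - 1) (q i) /\ forall j, j != i -> fnb 1 (k - 1) (q j).

(** The kind is read off from the directions other than x_i that carry a moment: none for the edges,
    one for the faces, both for the cell. *)
Lemma code_diag_kind i q : code_diag i q ->
  exists g, [/\ g \in dof_kinds k, dof_row g = i, dof_col g = i & code_for q g].
Proof.
move=> [qi qj].
have h m : ~~ is_der (q m) && (mom_deg (q m) < k - 1)%N.
  have [->|mi] := eqVneq m i; first by case: (q i) qi.
  by have := qj m mi; case: (q m) => //= _; rewrite subn_gt0 (leq_trans _ hk).
have im : is_mom (q i) by case: (q i) qi.
have gen s : (forall m, is_mom (q m) = (m \in s)) -> uniq s ->
    DofKind i i None [seq (m, k%:Z - 2) | m <- s] \in diag_kinds k i ->
    exists g, [/\ g \in dof_kinds k, dof_row g = i, dof_col g = i & code_for q g].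
  move=> hs us gk; exists (DofKind i i None [seq (m, k%:Z - 2) | m <- s]).
  split=> //; first exact: mem_diag_kinds gk.
  split=> m /=.
  - by have /andP[/negbTE] := h m.
  - by rewrite hs /unzip1 -map_comp map_id.
  - have /andP[_ hm] := h m; rewrite deg_map//.
    case: ifP => [_|]; first lia.
    by rewrite -hs; case: (q m).
have [j [l ui]] := uniq3_ex i.
have [[ij il jl] [ji li lj]] := uniq3P ui.
have kj m : m != i ->
    DofKind i i None [:: (i, k%:Z - 2); (m, k%:Z - 2)] \in diag_kinds k i.
  move=> mi; rewrite /diag_kinds in_cons mem_cat; apply/orP; right; apply/orP; left.
  by apply/mapP; exists m => //; rewrite mem_filter mi mem_enum.
case jm : (is_mom (q j)); case lm : (is_mom (q l)).
- apply: (gen (enum 'I_3)); first by apply: (forall_uniq3 ui); rewrite mem_enum.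
    exact: enum_uniq.
  by rewrite /diag_kinds in_cons mem_cat !inE eqxx !orbT.
- apply: (gen [:: i; j]); last by rewrite kj// ji.
    by apply: (forall_uniq3 ui); rewrite !inE ?eqxx ?orbT ?li ?lj.
  by rewrite /= inE ij.
- apply: (gen [:: i; l]); last by rewrite kj// li.
    by apply: (forall_uniq3 ui); rewrite !inE ?eqxx ?orbT ?ji ?jl.
  by rewrite /= inE il.
- apply: (gen [:: i]); last by rewrite /diag_kinds in_cons eqxx.
    by apply: (forall_uniq3 ui); rewrite !inE ?eqxx ?orbT ?li ?ji.
  by [].
Qed.

(* The functionals in x_l that accompany [qi] and [qj]: if both are moments then
   sigma_ij comes without its derivative on the faces F_ij, and the moments on T
   have two more degrees. *)
Definition code_third (qi qj : fn) : pred fn :=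
  if is_mom qi && is_mom qj then fnb 1 (k - 1) else fnb 2 (k - 3).

Local Ltac check_kind E :=
  rewrite /= /offdiag_kinds ?in_cons ?in_nil ?deg_cons ?deg_nil ?E ?orbT //;
  split; rewrite ?E; lia.

(** Neither x_i nor x_j carries a derivative, which leaves 2 * 2 * 3 combinations of values,
    derivatives and moments. The derivative in x_l next to two moments is excluded, and the other
    eleven are the eleven kinds. *)
Lemma code_offdiag_kind (i j l : 'I_3) q : (i < j)%N -> uniq [:: i; j; l] ->
  fnb 1 (k - 2) (q i) -> fnb 1 (k - 2) (q j) -> code_third (q i) (q j) (q l) ->
  exists g, [/\ g \in dof_kinds k, dof_row g = i, dof_col g = j & code_for q g].
Proof.
move=> lij u qi qj ql.
suff [der [s [gk hd hm hs]]] : exists (der : option 'I_3) (s : seq ('I_3 * int)),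
    [/\ DofKind i j der s \in offdiag_kinds k i j l,
        forall m, is_der (q m) = (der == Some m),
        forall m, is_mom (q m) = (m \in unzip1 s)
      & forall m, (mom_deg (q m))%:Z <= deg s m].
  by exists (DofKind i j der s); split=> //; exact: mem_offdiag_kinds gk.
have [[e1 e2 e3] [e4 e5 e6]] := uniq3P u.
have eS (m n : 'I_3) : (Some m == Some n) = (m == n) by [].
pose E := (e1, e2, e3, e4, e5, e6, eqxx, eS).
move: ql; rewrite /code_third.
have mk (der : option 'I_3) (s : seq ('I_3 * int)) :
    DofKind i j der s \in offdiag_kinds k i j l ->
    [/\ is_der (q i) = (der == Some i), is_der (q j) = (der == Some j)
      & is_der (q l) = (der == Some l)] ->
    [/\ is_mom (q i) = (i \in unzip1 s), is_mom (q j) = (j \in unzip1 s)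
      & is_mom (q l) = (l \in unzip1 s)] ->
    [/\ (mom_deg (q i))%:Z <= deg s i, (mom_deg (q j))%:Z <= deg s j
      & (mom_deg (q l))%:Z <= deg s l] ->
    exists (der : option 'I_3) (s : seq ('I_3 * int)),
    [/\ DofKind i j der s \in offdiag_kinds k i j l,
        forall m, is_der (q m) = (der == Some m),
        forall m, is_mom (q m) = (m \in unzip1 s)
      & forall m, (mom_deg (q m))%:Z <= deg s m].
  by move=> ? [? ? ?] [? ? ?] [? ? ?]; exists der, s; split=> //; apply: (forall_uniq3 u).
move: qi qj mk.
case: (q i) => [ci|ci|ni] //; case: (q j) => [cj|cj|nj] //;
  case: (q l) => [cl|cl|nl] //=.
all: move=> qi qj mk ql.
- by apply: (mk None [::]); check_kind E.
- by apply: (mk (Some l) [::]); check_kind E.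
- by apply: (mk None [:: (l, k%:Z - 4)]); check_kind E.
- by apply: (mk None [:: (j, k%:Z - 3)]); check_kind E.
- by apply: (mk (Some l) [:: (j, k%:Z - 3)]); check_kind E.
- by apply: (mk None [:: (j, k%:Z - 3); (l, k%:Z - 4)]); check_kind E.
- by apply: (mk None [:: (i, k%:Z - 3)]); check_kind E.
- by apply: (mk (Some l) [:: (i, k%:Z - 3)]); check_kind E.
- by apply: (mk None [:: (i, k%:Z - 3); (l, k%:Z - 4)]); check_kind E.
- by apply: (mk None [:: (i, k%:Z - 3); (j, k%:Z - 3)]); check_kind E.
- by apply: (mk None [:: (i, k%:Z - 3); (j, k%:Z - 3); (l, k%:Z - 2)]); check_kind E.
Qed.

End Codes.

(** * Separation of the entries by the codes, on cells and on faces *)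

Section Vanishing.
Variables (R : realType) (k : nat).
Hypothesis hk : (3 <= k)%N.
Implicit Types (q : code) (g : dof_kind) (T : cuboid R).

Lemma uniq2_ex (i j : 'I_3) : i != j -> exists l, uniq [:: i; j; l].
Proof.
move=> ij; have [m [l u]] := uniq3_ex i; have [[im il ml] [mi li lm]] := uniq3P u.
have := mem_uniq3 j u; rewrite !inE eq_sym (negbTE ij)/= => /orP[]/eqP ->.
  by exists l.
by exists m; rewrite /= !inE im il lm.
Qed.

(* The number of powers of x_m in the shape functions for sigma_ij. *)
Definition sdim (i j m : 'I_3) : nat :=
  if i == j then if m == i then (k - 1)%N else k.+1
  else if (m == i) || (m == j) then k else k.+1.

Definition deg_lt (d : 'I_3 -> nat) (p : mpoly3 R) :=
  forall m, m \in mpoly.msupp p -> forall i, (m i < d i)%N.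

Lemma cuboid_lt T i : lo T 0 i < hi T 0 i.
Proof. by have /forallP := lo_lt_hi T; apply. Qed.

Lemma Sigma_entry (s : 'rV[R]_3 -> 'M[R]_3) i j : Sigma k s ->
  exists2 p, deg_lt (sdim i j) p & (fun x => s x i j) = mfun p.
Proof.
move=> [_ sd so]; have [<-|ij] := eqVneq i j.
  have [m [l u]] := uniq3_ex i; have [p [hp sp]] := sd _ _ _ u.
  have [[im il ml] [mi li lm]] := uniq3P u.
  exists p; last by apply/funext => x; rewrite sp.
  move=> t tp n; have := hp t tp n; rewrite /sdim eqxx.
  move: n; apply: (forall_uniq3 u);
    rewrite !deg_cons deg_nil ?im ?il ?ml ?mi ?li ?lm ?eqxx ?addr0 ?add0r;
  move: (t _) => n; clear -hk; lia.
have [l u] := uniq2_ex ij.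
have [p [hp sp]] := so _ _ _ u.
have [[_ il jl] [ji li lj]] := uniq3P u.
exists p; last by apply/funext => x; rewrite sp.
move=> t tp n; have := hp t tp n; rewrite /sdim (negbTE ij).
move: n; apply: (forall_uniq3 u);
  rewrite !deg_cons deg_nil ?(negbTE ij) ?il ?jl ?ji ?li ?lj ?eqxx ?addr0 ?add0r /=;
  move: (t _) => n; clear -hk; lia.
Qed.

(* [fx m = Some c] freezes the variable x_m at the corresponding end point. *)
Section Frozen.
Variables (T : cuboid R) (fx : 'I_3 -> option bool).

Let fxb m (f : fn) :=
  if fx m is Some c then (if f is Ev c' then c == c' else false) else true.

Let fxW m : set (nat -> R) := [set w | forall c, fx m = Some c ->
  w = fun e => bound T c m ^+ e].

(** In a frozen variable the evaluation at the end point is itself one of the functionals, provided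
    that the values at the ends are among them, i.e. 0 < e. *)
Let forms_span_fx m e N d : (e <= 2)%N -> d = (N + e.*2)%N ->
  (fx m = None \/ (0 < e)%N) ->
  forms_span (lo T 0 m) (hi T 0 m) d [pred f | fnb e N f & fxb m f] (fxW m).
Proof.
move=> e2 dE; rewrite /forms_span /fxW /fxb; case fm : (fx m) => [c|] h0 p sp h w.
  move=> /(_ _ erefl) ->; have e0 : (0 < e)%N by case: h0.
  apply: (@forms_span_ev _ (lo T 0 m) (hi T 0 m) _ c _ _ _ sp h).
    by rewrite /= e0 eqxx.
  by apply/funext => j; rewrite /fval /= hornerXn.
move=> _; apply: (forms_span_fnb (cuboid_lt T m) e2 dE sp _ I) => f hf.
by apply: h; rewrite /= hf.
Qed.

(** With nothing frozen this is the separation on a cell, with x_n frozen it is the separation of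
    traces on a face. As sigma_ii has no end point functionals in x_i, that variable must stay
    free. *)
Lemma entry_vanish (i j : 'I_3) p : (i <= j)%N -> (i = j -> fx i = None) ->
  deg_lt (sdim i j) p ->
  (forall q g, g \in dof_kinds k -> dof_row g = i -> dof_col g = j ->
     code_for q g -> (forall m c, fx m = Some c -> q m = Ev c) ->
     tens (code_form T q) p = 0) ->
  forall L, (forall m c, fx m = Some c -> L m = fun e => bound T c m ^+ e) ->
  tens L p = 0.
Proof.
move=> ij fxi dp h L hL.
have hfx q m : fxb m (q m) -> forall c, fx m = Some c -> q m = Ev c.
  by rewrite /fxb => + c fm; rewrite fm; case: (q m) => // c' /eqP ->.
have [e|nij] := eqVneq i j.
  rewrite -{j}e in ij fxi dp h.
  have [j [l u]] := uniq3_ex i.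
  have [[e1 e2 e3] [e4 e5 e6]] := uniq3P u.
  apply: (tens_vanish dp u (forms_span_fx (e := 0) (N := k - 1) _ _ _)
    (forms_span_fx (e := 1) (N := k - 1) _ _ _)
    (fun _ _ _ _ => forms_span_fx (e := 1) (N := k - 1) _ _ _)) => //.
  - by rewrite /sdim !eqxx addn0.
  - by left; exact: fxi.
  - by rewrite /sdim eqxx e4/=; clear -hk; lia.
  - by right.
  - by rewrite /sdim eqxx e5/=; clear -hk; lia.
  - by right.
  - move=> q /andP[qi xi] /andP[qj xj] /andP[ql xl].
    have [|g [gk gr gc gq]] := @code_diag_kind k hk i q.
      split=> //; apply: (forall_uniq3 u) => //; by rewrite eqxx.
    apply: (h q g) => //; apply: (forall_uniq3 u); exact: hfx.
have lij : (i < j)%N by rewrite ltn_neqAle nij.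
have [l u] := uniq2_ex nij.
have [[e1 e2 e3] [e4 e5 e6]] := uniq3P u.
apply: (tens_vanish dp u (forms_span_fx (e := 1) (N := k - 2) _ _ _)
  (forms_span_fx (e := 1) (N := k - 2) _ _ _)
  (Wl := fun qi qj => [pred f | code_third k qi qj f & fxb l f])
  (W' := fxW)) => //.
- by rewrite /sdim e1 eqxx/=; clear -hk; lia.
- by right.
- by rewrite /sdim e1 eqxx orbT/=; clear -hk; lia.
- by right.
- move=> qi qj _ _; rewrite /code_third; case: ifP => _.
    apply: forms_span_fx => //; last by right.
    by rewrite /sdim e1 e5 e6/=; clear -hk; lia.
  apply: forms_span_fx => //; last by right.
  by rewrite /sdim e1 e5 e6/=; clear -hk; lia.
- move=> q /andP[qi xi] /andP[qj xj] /andP[ql xl].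
  have [g [gk gr gc gq]] := @code_offdiag_kind k hk i j l q lij u qi qj ql.
  by apply: (h q g) => //; apply: (forall_uniq3 u); exact: hfx.
Qed.

End Frozen.

Lemma tens_eq0 (p : mpoly3 R) : (forall L, tens L p = 0) -> p = 0.
Proof.
move=> h; apply/mpoly.mpolyP => m; rewrite mpoly.mcoeff0.
have [mp|/mpoly.memN_msupp_eq0 //] := boolP (m \in mpoly.msupp p).
(* The product of Kronecker deltas reads off the coefficient of [m]. *)
rewrite -(h (fun i e => (e == m i)%:R)) /tens /mlin (bigD1_seq m)//=.
rewrite [X in _ * X]big1 ?mulr1; last by move=> i _; rewrite eqxx.
rewrite big1 ?addr0// => n nm.
have [i ni] : exists i, n i != m i.
  apply/existsP; apply: contraNT nm; rewrite negb_exists => /forallP e.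
  by apply/eqP/mpoly.mnmP => i; apply/eqP; rewrite -[_ == _]negbK.
by rewrite (bigD1 i)//= (negbTE ni) mul0r mulr0.
Qed.

End Vanishing.

(** * Bases and dimensions *)

Section Bases.
Variables (R : fieldType) (V : lmodType R).

Definition indep n (e : 'I_n -> V) :=
  forall c : 'rV[R]_n, \sum_(i < n) c 0 i *: e i = 0 -> c = 0.

Lemma basis_indep (S : set V) (b : seq V) : S 0 -> is_basis S b ->
  indep (fun i : 'I_(size b) => b`_i).
Proof.
move=> S0 [_ /(_ _ S0)[c0 [_ uc0]]] c c00.
rewrite -(uc0 c)//; apply: uc0; rewrite big1// => i _.
by rewrite mxE scale0r.
Qed.

(** The coordinates of the family [f] form a matrix; a row of its left kernel is a linear relation
    between the [f i], so the rank is [m]. *)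
Lemma indep_leq m n (f : 'I_m -> V) (e : 'I_n -> V) : indep f ->
  (forall i, exists c : 'rV[R]_n, f i = \sum_(j < n) c 0 j *: e j) -> (m <= n)%N.
Proof.
move=> fi /fin_all_exists[c hc].
suff /eqP <- : row_free (\matrix_i c i) by exact: rank_leq_col.
rewrite -kermx_eq0; apply/eqP/row_matrixP => r; rewrite row0.
set K := kermx _; apply: fi.
under eq_bigr => i _.
  rewrite hc scaler_sumr; under eq_bigr do rewrite scalerA.
  over.
rewrite exchange_big/=; apply: big1 => j _; rewrite -scaler_suml.
have /rowP/(_ j) : row r K *m \matrix_i c i = 0 by rewrite -row_mul mulmx_ker row0.
rewrite !mxE => e0.
rewrite [X in X *: _](_ : _ = 0) ?scale0r// -[RHS]e0.
by apply: eq_bigr => i _; rewrite !mxE.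
Qed.

Variable S : set V.
Hypothesis S0 : S 0.
Hypothesis SP : forall a u v, S u -> S v -> S (a *: u + v).

Definition inS v (Sv : S v) : set_type S := SigSub (mem_set Sv).

Lemma S_sum n (c : 'I_n -> R) (e : 'I_n -> V) : (forall i, S (e i)) ->
  S (\sum_(i < n) c i *: e i).
Proof.
move=> Se; elim/big_ind : _ => // [u v Su Sv|i _].
  by rewrite -[u]scale1r; exact: SP.
by rewrite -[_ *: _]addr0; exact: SP.
Qed.

(** [dual] states linearity for one combination a u + v at a time, through the underlying vectors;
    hence the induction on [n]. *)
Lemma dual_sum n (psi : set_type S -> R^o) (c : 'I_n -> R) (e : 'I_n -> V)
    (Se : forall i, S (e i)) (u : set_type S) : dual psi ->
  set_val u = \sum_(i < n) c i *: e i ->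
  psi u = \sum_(i < n) c i * psi (inS (Se i)).
Proof.
move=> dpsi.
have psi0 w : set_val w = 0 -> psi w = 0.
  move=> w0; have := dpsi 1 w w w; rewrite w0 scaler0 addr0 => /(_ erefl).
  by rewrite mul1r => /eqP; rewrite -subr_eq0 opprD addrA subrr add0r oppr_eq0 => /eqP.
elim: n c e Se u => [|n IH] c e Se u; rewrite !(big_ord0, big_ord_recr)/=.
  exact: psi0.
pose v := inS (S_sum (fun i : 'I_n => c (widen_ord (leqnSn n) i))
                (fun i : 'I_n => Se (widen_ord (leqnSn n) i))).
move=> uE; rewrite (dpsi (c ord_max) (inS (Se ord_max)) v u); last first.
  by rewrite uE addrC.
by rewrite addrC (IH _ _ (fun i => Se (widen_ord (leqnSn n) i)) v erefl).
Qed.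

Lemma dual_comb n (psi : set_type S -> R^o) (e : 'I_n -> V)
    (Se : forall i, S (e i)) (c : 'I_n -> R) : dual psi ->
  psi (inS (S_sum c Se)) = \sum_(i < n) c i * psi (inS (Se i)).
Proof. by move=> dpsi; exact: dual_sum. Qed.

(** The matrix of the values of the functionals at the vectors [e] is square, and separation makes
    its left kernel trivial. That [e] generates [S] is a consequence, so it is enough to produce one
    independent vector per functional. *)
Lemma dual_basis (D : seq (set_type S -> R^o)) (e : 'I_(size D) -> V) :
  (forall i, S (e i)) -> indep e ->
  (forall i, (i < size D)%N -> dual D`_i) ->
  (forall u : set_type S, (forall i, (i < size D)%N -> D`_i u = 0) ->
     set_val u = 0) ->
  is_basis (dual (S := S)) D.
Proof.
move=> Se ei dD sep; split=> // psi dpsi.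
pose M : 'M[R]_(size D) := \matrix_(i, j) D`_j (inS (Se i)).
have MU : M \in unitmx.
  rewrite -row_free_unit -kermx_eq0; apply/eqP/row_matrixP => r; rewrite row0.
  apply: ei; pose u := inS (S_sum (fun i => (row r (kermx M)) 0 i) Se).
  rewrite -[LHS]/(set_val u); apply: sep => j jD.
  rewrite (dual_comb Se _ (dD _ jD)).
  have /rowP/(_ (Ordinal jD)) : row r (kermx M) *m M = 0 by rewrite -row_mul mulmx_ker row0.
  rewrite !mxE => e0; rewrite -[RHS]e0; apply: eq_bigr => i _.
  by rewrite !mxE.
pose y : 'cV[R]_(size D) := \col_i psi (inS (Se i)).
(* Subtract from u the combination of the [e i] with the same values under [D]: the difference is
   killed by all of [D]. *)
have span (u : set_type S) : exists a : 'rV[R]_(size D),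
    set_val u = \sum_(i < size D) a 0 i *: e i.
  pose b : 'rV[R]_(size D) := \row_j D`_j u.
  exists (b *m invmx M); set a := _ *m _.
  have Sw : S (1 *: set_val u + \sum_(i < size D) (- a 0 i) *: e i).
    by apply: SP; [exact: set_valP|exact: S_sum].
  have : 1 *: set_val u + \sum_(i < size D) (- a 0 i) *: e i = 0.
    rewrite -[LHS]/(set_val (inS Sw)); apply: sep => j jD.
    pose v := inS (S_sum (fun i => - a 0 i) Se).
    rewrite (dD _ jD 1 u v)// mul1r (dual_comb Se _ (dD _ jD)).
    have /rowP/(_ (Ordinal jD)) : a *m M = b by rewrite mulmxKV.
    rewrite !mxE => <-; apply/eqP; rewrite addr_eq0 -sumrN; apply/eqP.
    by apply: eq_bigr => i _; rewrite ?mxE mulNr opprK.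
  rewrite scale1r => /eqP; rewrite addr_eq0 => /eqP ->.
  by rewrite -sumrN; apply: eq_bigr => i _; rewrite scaleNr opprK.
(* The equations psi(e_i) = sum_j M_ij c_j determine the coordinates c. *)
exists (invmx M *m y)^T; split.
  apply/funext => u; have [a ua] := span u.
  rewrite (dual_sum Se dpsi ua).
  have -> : (\sum_(j < size D) (invmx M *m y)^T 0 j *: D`_j) u =
      \sum_(j < size D) (invmx M *m y)^T 0 j * D`_j u.
    rewrite fct_sumE; apply: eq_bigr => j _; exact: erefl.
  under [RHS]eq_bigr => j _ do
    rewrite (dual_sum Se (dD _ (ltn_ord j)) ua) mulr_sumr.
  rewrite exchange_big/=; apply: eq_bigr => i _.
  have /colP/(_ i) : M *m (invmx M *m y) = y by rewrite mulKVmx.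
  rewrite !mxE => <-; rewrite mulr_sumr; apply: eq_bigr => j _.
  by rewrite [M i j]mxE [_^T _ _]mxE mulrA mulrC.
move=> c psic; apply: trmx_inj; rewrite trmxK.
suff -> : y = M *m c^T by rewrite mulKmx.
apply/colP => i; rewrite !mxE psic fct_sumE; apply: eq_bigr => j _.
by rewrite !mxE mulrC.
Qed.

End Bases.

(** * Polynomial functions and their monomials *)

Section Monomials.
Variable R : realType.
Implicit Types p : mpoly3 R.

Lemma mfun_is_linear : linear (@mfun R).
Proof.
move=> a p q; apply/funext => x.
by rewrite /mfun mpoly.mevalD mpoly.mevalZ.
Qed.

HB.instance Definition _ :=
  GRing.isLinear.Build R (mpoly3 R) ('rV[R]_3 -> R) *:%R (@mfun R) mfun_is_linear.

(** All moments of [p] over the cuboid are integrals of the zero function, and the moments separate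
    polynomials. *)
Lemma mfun_eq0 (T : cuboid R) p : mfun p = 0 -> p = 0.
Proof.
move=> p0; pose d (i : 'I_3) := mpoly.mmeasure mpoly.mdeg p.
have dp : deg_lt d p.
  move=> m /mpoly.msize_mdeg_lt + i; apply: leq_ltn_trans.
  by rewrite mpoly.mdegE (bigD1 i)//= leq_addr.
have [j [l u]] := uniq3_ex 0.
apply: tens_eq0 => L.
have sp i : forms_span (lo T 0 i) (hi T 0 i) (d i) (fnb 0 (d i)) setT.
  by apply: (forms_span_fnb (cuboid_lt T i)) => //; rewrite addn0.
apply: (tens_vanish dp u (sp _) (sp _) (fun _ _ _ _ => sp _) _
  (W' := fun=> setT)) => // q q0 qj ql.
have qm : forall i, is_mom (q i).
  by apply: (forall_uniq3 u); [case: (q 0) q0|case: (q j) qj|case: (q l) ql].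
(* A field with all entries equal to [p], so that its moments are degrees of freedom. *)
pose s x : 'M[R]_3 := const_mx (mfun p x).
rewrite -(@dof_codeE _ T (DofKind 0 0 None [::]) q p s)//=.
- rewrite (@dofE _ T _ _ 0)/= ?mul0r ?linear0//.
  by apply/funext => x; rewrite /s mxE p0.
- by apply/funext => x; rewrite /s mxE.
- by move=> i; have := qm i; case: (q i).
Qed.

Variable K : nat.

Definition mnm (m : {ffun 'I_3 -> 'I_K}) : mon :=
  mpoly.Multinom [tuple (m i : nat) | i < 3].

Lemma mnmE m i : mnm m i = m i :> nat.
Proof. by rewrite mpoly.mnmE. Qed.

Lemma mnm_inj : injective mnm.
Proof.
move=> m1 m2 e; apply/ffunP => i; apply/val_inj.
by rewrite /= -!mnmE e.
Qed.

Definition bset (d : 'I_3 -> nat) : {set {ffun 'I_3 -> 'I_K}} :=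
  [set m : {ffun 'I_3 -> 'I_K} | [forall n, (m n < d n)%N]]%SET.

Lemma card_bset d : (forall n, (d n <= K)%N) -> #|bset d| = (\prod_n d n)%N.
Proof.
move=> dK; pose F (n : 'I_3) : pred 'I_K := fun a => (a < d n)%N.
rewrite (_ : #|bset d| = #|(family F : pred _)|); last first.
  by apply: eq_card => m; rewrite inE; apply: eq_forallb.
rewrite card_family foldrE big_map big_enum; apply: eq_bigr => n _.
rewrite -sum1_card -(big_ord_widen_cond _ predT (fun=> 1%N) (dK n)).
by rewrite sum1_card card_ord.
Qed.

Lemma mfun_bset d p : (forall n, (d n <= K)%N) -> deg_lt d p ->
  mfun p = \sum_(m in bset d) mpoly.mcoeff (mnm m) p *: mfun 'X^{mnm m}.
Proof.
move=> dK dp; apply/funext => x; rewrite fct_sumE.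
rewrite {1}/mfun meval_tens /tens (@mlin_widen _ _ _ [seq mnm m | m <- enum (bset d)]).
- rewrite big_map big_enum; apply: eq_bigr => m _.
  by rewrite /mfun -[RHS]/(_ * _) mpoly.mevalX.
- by rewrite map_inj_uniq ?enum_uniq//; exact: mnm_inj.
- move=> m mp; apply/mapP.
  have mK i : (m i < K)%N by rewrite (leq_trans (dp _ mp i)).
  exists [ffun i => Ordinal (mK i)]; last first.
    by apply/mpoly.mnmP => i; rewrite mnmE ffunE.
  by rewrite mem_enum inE; apply/forallP => i; rewrite ffunE/=; exact: dp.
Qed.

End Monomials.

(** * The number of degrees of freedom *)

Section Counting.

Lemma big_uniq3 (T : Type) (idx : T) (op : Monoid.com_law idx) (F : 'I_3 -> T)
    (i j l : 'I_3) : uniq [:: i; j; l] ->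
  \big[op/idx]_(n < 3) F n = op (F i) (op (F j) (F l)).
Proof.
move=> u; rewrite -big_enum (perm_big [:: i; j; l]).
  by rewrite !big_cons big_nil Monoid.mulm1.
apply: uniq_perm => //; first exact: enum_uniq.
by move=> m; rewrite mem_enum mem_uniq3.
Qed.

Definition qdim (d : int) : nat := if d is Posz n then n.+1 else 0%N.

(** Truncated subtraction agrees with the convention that a negative bound gives the zero space. *)
Lemma qdim_subn (k n : nat) : qdim (k%:Z - n%:Z) = (k.+1 - n)%N.
Proof.
case: (leqP n k) => h; first by rewrite subzn// subSn.
by rewrite -opprB subzn ?(ltnW h)//; case e : (n - k)%N => [|m] /=; lia.
Qed.

Lemma qdim_kinds (k : nat) :
  (qdim (k%:Z - 2) = k - 1)%N * (qdim (k%:Z - 3) = k - 2)%N *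
  (qdim (k%:Z - 4) = k - 3)%N.
Proof.
split; [split|].
- by have := qdim_subn k 2; rewrite subSS.
- by have := qdim_subn k 3; rewrite subSS.
- by have := qdim_subn k 4; rewrite subSS.
Qed.

Lemma ltz_qdim (n : nat) (d : int) : (n%:Z <= d) = (n < qdim d)%N.
Proof. by case: d. Qed.

Lemma deg_notin s (n : 'I_3) : n \notin unzip1 s -> deg s n = 0.
Proof.
elim: s => [|[m a] s IH]; first by rewrite deg_nil.
rewrite /= inE negb_or => /andP[nm ns].
by rewrite deg_cons IH// eq_sym (negbTE nm).
Qed.

Lemma card_spans (D : seq 'I_3) :
  size [seq E <- enum {: entity} | spans E D] =
  (\prod_(n < 3) (if n \in D then 1 else 2))%N.
Proof.
pose F (n : 'I_3) : pred (option bool) := fun o => (o == None) == (n \in D).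
rewrite size_filter -sum1_count big_enum_cond/=.
rewrite sum1_card (_ : #|_| = #|(family F : pred _)|); last first.
  by apply: eq_card => E; rewrite !inE; apply: eq_forallb.
rewrite card_family foldrE big_map big_enum; apply: eq_bigr => n _.
rewrite /F; case: ifP => _.
  by rewrite -(card1 (@None bool)); apply: eq_card => -[[]|].
rewrite (@eq_card _ _ (predC1 None)) ?cardC1 ?card_option ?card_bool//.
by move=> [b|]; rewrite unfold_in/= ?inE.
Qed.

(** Each direction contributes a factor: the number of moments if it is listed, otherwise 2 for the
    choice of the end point. *)
Definition kind_dim (g : dof_kind) : nat :=
  \prod_(n < 3) (if n \in unzip1 (dof_tests g) then qdim (deg (dof_tests g) n) else 2).

(** Edges, faces and cell contribute 4 (k - 1), 4 (k - 1)^2 and (k - 1)^3, with sum (k - 1) ((k - 1)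
    + 2)^2. *)
Lemma sum_diag_kinds k i : (3 <= k)%N ->
  (\sum_(g <- diag_kinds k i) kind_dim g = (k - 1) * k.+1 ^ 2)%N.
Proof.
move=> hk; have [j [l u]] := uniq3_ex i.
have [[e1 e2 e3] [e4 e5 e6]] := uniq3P u.
have pu m : (m != i) -> kind_dim (DofKind i i None [:: (i, k%:Z - 2); (m, k%:Z - 2)]) =
    ((k - 1) * (k - 1) * 2)%N.
  rewrite eq_sym => mi; have [n v] := uniq2_ex mi.
  have [[f1 f2 f3] [f4 f5 f6]] := uniq3P v.
  rewrite /kind_dim (big_uniq3 _ _ v)/= !inE !deg_cons !deg_nil.
  rewrite !eqxx ?f1 ?f2 ?f3 ?f4 ?f5 ?f6/= ?addr0 ?add0r !qdim_kinds.
  by rewrite mulnA.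
rewrite big_cons big_cat/= big_cons big_nil addn0 big_map big_filter.
rewrite (eq_bigr (fun=> ((k - 1) * (k - 1) * 2)%N) pu) big_enum_cond/=.
rewrite sum_nat_const cardC1 card_ord.
rewrite /kind_dim !(big_uniq3 _ _ u)/= !inE !deg_cons !deg_nil.
have en m : m \in unzip1 [seq (m, k%:Z - 2) | m <- enum 'I_3].
  by rewrite /unzip1 -map_comp map_id mem_enum.
rewrite !en !deg_map ?enum_uniq// !mem_enum.
rewrite !eqxx ?e1 ?e2 ?e3 ?e4 ?e5 ?e6/= ?addr0 ?add0r !qdim_kinds.
case: k hk {en pu} => // n _; rewrite subn1/=; nia.
Qed.

(** With a = k - 2 and c = k - 3 the sum is (a + 2)^2 (c + 4): each of the a^2 pairs of moments in
    x_i and x_j loses the two derivatives at the ends in x_l and gains two moments. *)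
Lemma sum_offdiag_kinds k (i j l : 'I_3) : (3 <= k)%N -> uniq [:: i; j; l] ->
  (\sum_(g <- offdiag_kinds k i j l) kind_dim g = k ^ 2 * k.+1)%N.
Proof.
move=> hk u; have [[e1 e2 e3] [e4 e5 e6]] := uniq3P u.
rewrite !big_cons big_nil /kind_dim !(big_uniq3 _ _ u)/= !in_cons !in_nil !deg_cons !deg_nil.
rewrite !eqxx ?e1 ?e2 ?e3 ?e4 ?e5 ?e6/= ?addr0 ?add0r !qdim_kinds.
case: k hk => [|[|[|n]]] // _.
rewrite ?subSS ?subn0 ?subn1/=; ring.
Qed.

Lemma sum_dof_kinds k : (3 <= k)%N ->
  (\sum_(g <- dof_kinds k) kind_dim g =
   3 * ((k - 1) * k.+1 ^ 2) + 3 * (k ^ 2 * k.+1))%N.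
Proof.
move=> hk; rewrite big_cat; congr addn.
  rewrite big_flatten big_map (eq_bigr _ (fun i _ => sum_diag_kinds i hk)).
  by rewrite big_const_seq count_predT size_enum_ord iter_addn_0 mulnC.
rewrite big_flatten big_map big_filter (eq_bigr (fun=> k ^ 2 * k.+1)%N); last first.
  by move=> q /andP[_ u]; exact: sum_offdiag_kinds.
rewrite big_enum_cond/= sum_nat_const; congr muln.
rewrite -sum1_card big_mkcond/=.
rewrite -(pair_bigA _ (fun (ij : 'I_3 * 'I_3) (l : 'I_3) =>
  if (ij.1 < ij.2)%N && uniq [:: ij.1; ij.2; l] then 1%N else 0%N))/=.
rewrite -(pair_bigA _ (fun i j : 'I_3 =>
  \sum_(l < 3) if (i < j)%N && uniq [:: i; j; l] then 1%N else 0%N)%N)/=.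
by rewrite !big_ord_recl !big_ord0.
Qed.

End Counting.

(** * Unisolvence *)

Section Spaces.
Variable R : realType.

(** Strict bounds by [qdim] cover the negative degrees without a case distinction, as no exponent is
    less than 0. *)
Lemma QpolyP s (f : 'rV[R]_3 -> R) :
  Qpoly s f <-> exists2 p, deg_lt (fun n => qdim (deg s n)) p & f = mfun p.
Proof.
split=> [[p [hp fp]]|[p hp ->]].
  exists p; last exact/funext.
  by move=> m mp i; rewrite -ltz_qdim; exact: hp.
by exists p; split=> // m mp i; rewrite ltz_qdim; exact: hp.
Qed.

Lemma deg_lt0 d : deg_lt (R := R) d 0.
Proof. by move=> m; rewrite mpoly.msupp0. Qed.

Lemma deg_ltP d a (p q : mpoly3 R) : deg_lt d p -> deg_lt d q ->
  deg_lt d (a *: p + q).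
Proof.
move=> hp hq m /mpoly.msuppD_le; rewrite mem_cat => /orP[/mpoly.msuppZ_le|].
  exact: hp.
exact: hq.
Qed.

Lemma Qpoly0 s : @Qpoly R s 0.
Proof.
apply/QpolyP; exists 0; first exact: deg_lt0.
by rewrite linear0.
Qed.

Lemma Qpoly_linear s a (f g : 'rV[R]_3 -> R) :
  Qpoly s f -> Qpoly s g -> Qpoly s (a *: f + g).
Proof.
move=> /QpolyP[p hp ->] /QpolyP[q hq ->]; apply/QpolyP.
by exists (a *: p + q); [exact: deg_ltP|rewrite linearP].
Qed.

Lemma Sigma0 k : @Sigma R k 0.
Proof.
split=> [x|i j l u|i j l u]; first exact: trmx0.
- rewrite (_ : (fun _ => _) = 0); first exact: Qpoly0.
  by apply/funext => x; rewrite mxE.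
- rewrite (_ : (fun _ => _) = 0); first exact: Qpoly0.
  by apply/funext => x; rewrite mxE.
Qed.

Lemma entry_linear a (u v : 'rV[R]_3 -> 'M[R]_3) i j :
  (fun x => (a *: u + v) x i j) = a *: (fun x => u x i j) + (fun x => v x i j).
Proof. by apply/funext => x; rewrite mxE; congr (_ + _); rewrite mxE. Qed.

Lemma Sigma_linear k a (u v : 'rV[R]_3 -> 'M[R]_3) :
  Sigma k u -> Sigma k v -> Sigma k (a *: u + v).
Proof.
move=> [ut ud uo] [vt vd vo].
split=> [x|i j l h|i j l h].
- by rewrite -[(a *: u + v) x]/(a *: u x + v x) linearP/= ut vt.
- by rewrite entry_linear; apply: Qpoly_linear; [exact: ud h|exact: vd h].
- by rewrite entry_linear; apply: Qpoly_linear; [exact: uo h|exact: vo h].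
Qed.

Lemma basis_Qpoly_size s (b : seq ('rV[R]_3 -> R)) : is_basis (Qpoly s) b ->
  (size b <= \prod_(n < 3) qdim (deg s n))%N.
Proof.
move=> hb; pose d n := qdim (deg s n); pose K := (\max_n d n)%N.
have dK n : (d n <= K)%N by exact: leq_bigmax.
rewrite -[leqRHS](card_bset dK).
apply: (indep_leq (e := fun i : 'I_#|bset K d| => mfun 'X^{mnm (enum_val i)})
  (basis_indep (Qpoly0 s) hb)) => i.
have /QpolyP[p hp ->] := hb.1 i (ltn_ord i).
exists (\row_j mpoly.mcoeff (mnm (enum_val j)) p).
by rewrite (mfun_bset dK hp) big_enum_val; apply: eq_bigr => j _; rewrite mxE.
Qed.

Lemma indep_inj (V : lmodType R) m n (e : 'I_n -> V) (h : 'I_m -> 'I_n) :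
  injective h -> indep e -> indep (e \o h).
Proof.
move=> hi ei c c0; pose c' : 'rV[R]_n := \sum_i c 0 i *: delta_mx 0 (h i).
have c'E j : c' 0 j = \sum_i c 0 i * (j == h i)%:R.
  by rewrite summxE; apply: eq_bigr => i _; rewrite !mxE eqxx.
have /ei c'0 : \sum_j c' 0 j *: e j = 0.
  rewrite -[RHS]c0; under eq_bigr do rewrite c'E scaler_suml.
  rewrite exchange_big/=; apply: eq_bigr => i _.
  rewrite (bigD1 (h i))//= eqxx mulr1 big1 ?addr0// => j /negbTE ->.
  by rewrite mulr0 scale0r.
apply/rowP => i; have := c'E (h i); rewrite c'0 !mxE (bigD1 i)//= eqxx mulr1.
rewrite big1 ?addr0// => j ji; rewrite (inj_eq hi) eq_sym (negbTE ji).
by rewrite mulr0.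
Qed.

Variable k : nat.
Hypothesis hk : (3 <= k)%N.

Definition sindex := ('I_3 * 'I_3 * {ffun 'I_3 -> 'I_k.+1})%type.

Definition sindices : {set sindex} :=
  [set t : sindex | (t.1.1 <= t.1.2)%N && (t.2 \in bset k.+1 (sdim k t.1.1 t.1.2))]%SET.

(** One monomial, placed in the entries (i, j) and (j, i); the indices with i <= j list every
    symmetric pair of entries once. *)
Definition sfield (t : sindex) (x : 'rV[R]_3) : 'M[R]_3 :=
  \matrix_(i, j) if ((i, j) == t.1) || ((j, i) == t.1) then mfun 'X^{mnm t.2} x else 0.

Lemma sdim_le i j n : (sdim k i j n <= k.+1)%N.
Proof. by rewrite /sdim; do 2?case: ifP; rewrite ?leq_subr ?leqnSn// => *; lia. Qed.

Lemma sdimC i j n : sdim k i j n = sdim k j i n.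
Proof.
by rewrite /sdim eq_sym orbC; case: eqP => [->|].
Qed.

Lemma card_sindices : #|sindices| =
  (3 * ((k - 1) * k.+1 ^ 2) + 3 * (k ^ 2 * k.+1))%N.
Proof.
rewrite -sum1_card /sindices (eq_bigl (fun t : sindex => (t.1.1 <= t.1.2)%N &&
  (t.2 \in bset k.+1 (sdim k t.1.1 t.1.2)))); last by move=> t; rewrite inE.
rewrite -(pair_big_dep (fun ij : 'I_3 * 'I_3 => (ij.1 <= ij.2)%N)
  (fun ij m => m \in bset k.+1 (sdim k ij.1 ij.2)) (fun _ _ => 1%N))/=.
under eq_bigr => ij _ do rewrite sum1_card (card_bset (sdim_le _ _)).
rewrite -(pair_big_dep predT (fun i j : 'I_3 => (i <= j)%N)
  (fun i j => \prod_n sdim k i j n)%N)/=.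
have dd (i : 'I_3) : (\prod_n sdim k i i n = (k - 1) * k.+1 ^ 2)%N.
  have [j [l u]] := uniq3_ex i; have [[e1 e2 e3] [e4 e5 e6]] := uniq3P u.
  by rewrite (big_uniq3 _ _ u) /sdim !eqxx e4 e5.
have od (i j : 'I_3) : i != j -> (\prod_n sdim k i j n = k ^ 2 * k.+1)%N.
  move=> ij; have [l u] := uniq2_ex ij; have [[e1 e2 e3] [e4 e5 e6]] := uniq3P u.
  by rewrite (big_uniq3 _ _ u) /sdim !eqxx e1 e4 e5 e6/= mulnA.
under eq_bigr => i _.
  rewrite (bigD1 i)//= dd (eq_bigr (fun=> (k ^ 2 * k.+1)%N)); last first.
    by move=> j /andP[_]; rewrite eq_sym; exact: od.
  rewrite sum_nat_const -sum1_card big_mkcond/=.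
  over.
by rewrite !big_ord_recl !big_ord0/=; nia.
Qed.

Lemma sfield_Sigma t : t \in sindices -> Sigma k (sfield t).
Proof.
rewrite inE => /andP[t12 /=]; rewrite inE => /forallP ht.
have q0 s : Qpoly s (fun=> 0 : R) by exact: (Qpoly0 s).
have mon s : (forall n, (t.2 n < qdim (deg s n))%N) ->
    Qpoly s (fun x : 'rV[R]_3 => mfun 'X^{mnm t.2} x).
  move=> h; apply/QpolyP; exists 'X^{mnm t.2} => // m.
  by rewrite mpoly.msuppX inE => /eqP -> i; rewrite mnmE.
have hd n : (t.2 n < sdim k t.1.1 t.1.2 n)%N := ht n.
clear ht.
have ent s i j : ((i, j) == t.1) || ((j, i) == t.1) ->
   (forall n, sdim k i j n = qdim (deg s n)) ->
   forall n, (t.2 n < qdim (deg s n))%N.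
  move=> /orP[]/eqP e h n; have := hd n; rewrite -e -h//=.
  by rewrite sdimC.
have k1 : qdim k = k.+1 by [].
have q1 : qdim (k%:Z - 1) = k by have := qdim_subn k 1; rewrite subSS subn0.
split=> [x|i j l u|i j l u].
- by apply/matrixP => i j; rewrite !mxE orbC.
- rewrite (_ : (fun _ => _) = fun x =>
      if ((i, i) == t.1) || ((i, i) == t.1) then mfun 'X^{mnm t.2} x else 0);
    last first.
    by apply/funext => x; rewrite mxE.
  case: (boolP (_ || _)) => [/ent e|_]; last exact: q0.
  apply: mon; apply: e.
  have [[e1 e2 e3] [e4 e5 e6]] := uniq3P u.
  by apply: (forall_uniq3 u); rewrite !deg_cons !deg_nil /sdim !eqxx
    ?e1 ?e2 ?e3 ?e4 ?e5 ?e6 ?addr0 ?add0r ?qdim_kinds.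
- rewrite (_ : (fun _ => _) = fun x =>
      if ((i, j) == t.1) || ((j, i) == t.1) then mfun 'X^{mnm t.2} x else 0);
    last first.
    by apply/funext => x; rewrite mxE.
  case: (boolP (_ || _)) => [/ent e|_]; last exact: q0.
  apply: mon; apply: e.
  have [[e1 e2 e3] [e4 e5 e6]] := uniq3P u.
  by apply: (forall_uniq3 u); rewrite !deg_cons !deg_nil /sdim !eqxx
    ?e1 ?e2 ?e3 ?e4 ?e5 ?e6 ?addr0 ?add0r ?q1.
Qed.

Lemma sfield_indep (T : cuboid R) :
  indep (fun i : 'I_#|sindices| => sfield (enum_val i)).
Proof.
move=> c c0; apply/rowP => i0; rewrite mxE.
set t0 := enum_val i0.
have t0A : t0 \in sindices by exact: enum_valP.
(* The entry [t0.1] of the combination, as a polynomial; its coefficient at the monomial of [t0] is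
   [c 0 i0]. *)
pose P : mpoly3 R := \sum_(i < #|sindices|)
  (c 0 i * ((enum_val i).1 == t0.1)%:R) *: 'X^{mnm (enum_val i).2}.
have P0 : P = 0.
  apply: (mfun_eq0 T); apply/funext => x; rewrite linear_sum fct_sumE.
  have e0 : \sum_i (c 0 i *: sfield (enum_val i) x) t0.1.1 t0.1.2 = 0.
    have := congr1 (fun f : 'rV[R]_3 -> 'M[R]_3 => f x t0.1.1 t0.1.2) c0.
    by rewrite fct_sumE summxE => ->; rewrite mxE.
  rewrite -[RHS]e0.
  apply: eq_bigr => i _; rewrite linearZ -[LHS]/(_ * _).
  rewrite !mxE -mulrA; congr (_ * _).
  have := enum_valP i; rewrite inE => /andP[ile _].
  move: t0A; rewrite inE => /andP[t0le _].
  rewrite -surjective_pairing eq_sym.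
  (* Both pairs of indices are ordered, so the transposed one can match only on the diagonal, where
     it is the same pair. *)
  have -> : ((t0.1.2, t0.1.1) == (enum_val i).1) =
      ((t0.1.2, t0.1.1) == (enum_val i).1) && (t0.1 == (enum_val i).1).
    apply/idP/andP => [/eqP e|[]//]; rewrite {1}e eqxx; split=> //.
    move: ile; rewrite -e/= => t0le'.
    have e' : t0.1.1 = t0.1.2 by apply/val_inj/eqP; rewrite eqn_leq t0le.
    by case: (t0.1) e' => a b /= ->.
  by case: (t0.1 == _); rewrite ?andbT ?andbF ?mul1r ?mul0r.
have := congr1 (mpoly.mcoeff (mnm t0.2)) P0.
rewrite mpoly.mcoeff0 raddf_sum/= (bigD1 i0)//= mpoly.mcoeffZ mpoly.mcoeffX !eqxx !mulr1.
rewrite big1 ?addr0// => i ii0; rewrite mpoly.mcoeffZ mpoly.mcoeffX.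
rewrite (inj_eq (@mnm_inj _)) -mulrA -natrM mulnb.
case: eqP => //= [e1|_]; last by rewrite mulr0.
case: eqP => [e2|_]; last by rewrite mulr0.
case/eqP: ii0; apply: enum_val_inj; rewrite [enum_val i]surjective_pairing e1 e2.
by rewrite -surjective_pairing.
Qed.

End Spaces.

Section Unisolvence.
Variables (R : realType) (k : nat) (T : cuboid R).
Variable B : dof_kind -> entity -> seq ('rV[R]_3 -> R).
Hypothesis hk : (3 <= k)%N.
Hypothesis hB : forall g E, g \in dof_kinds k ->
  is_basis (@Qpoly R (dof_tests g)) (B g E).

Let tests g E := if nilp (dof_tests g) then [:: cst 1] else B g E.
Let ents g := [seq E <- enum {: entity} | spans E (unzip1 (dof_tests g))].
Let index := flatten [seq [seq (g, E, p) | p <- tests g E]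
                     | g <- dof_kinds k, E <- ents g].

Let test_mfun g E i : g \in dof_kinds k -> (i < size (tests g E))%N ->
  exists p, (tests g E)`_i = mfun p.
Proof.
move=> gk; rewrite /tests; case: ifP => [_|_ ib].
  case: i => //= _; exists 1; apply/funext => x.
  by rewrite /mfun mpoly.meval1.
by have /QpolyP[p _ ->] := (hB E gk).1 i ib; exists p.
Qed.

Let index_mfun q : q \in index -> q.1.1 \in dof_kinds k /\ exists p, q.2 = mfun p.
Proof.
move=> /flattenP[_ /allpairsPdep[g [E [gk _ ->]]] /mapP[p /(nthP 0)[i ip <-] ->]] /=.
by split=> //; exact: test_mfun.
Qed.

Lemma dofs_nth i : (i < size (dofs k T B))%N -> exists q, [/\
  q.1.1 \in dof_kinds k, exists p, q.2 = mfun p &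
  (dofs k T B)`_i = fun s => dof T q.1.1 q.1.2 q.2 (set_val s)].
Proof.
move=> iD; have iI : (i < size index)%N by rewrite size_map in iD.
pose q := nth (DofKind 0 0 None [::], cell_entity, 0) index i.
have [h1 h2] := index_mfun (mem_nth (DofKind 0 0 None [::], cell_entity, 0) iI).
exists q; split=> //.
by rewrite /dofs (nth_map (DofKind 0 0 None [::], cell_entity, 0)).
Qed.

Lemma dofs_dual i : (i < size (dofs k T B))%N -> dual (dofs k T B)`_i.
Proof.
move=> /dofs_nth[q [gk [r rE] ->]] a u v w wE; rewrite rE.
have [pu _ eu] := Sigma_entry hk (dof_row q.1.1) (dof_col q.1.1) (set_valP u).
have [pv _ ev] := Sigma_entry hk (dof_row q.1.1) (dof_col q.1.1) (set_valP v).
rewrite (dofE T q.1.2 r eu) (dofE T q.1.2 r ev).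
rewrite (@dofE _ T _ q.1.2 (a *: pu + pv)); last first.
  rewrite (_ : mfun _ = a *: mfun pu + mfun pv); last exact: mfun_is_linear.
  by rewrite -eu -ev wE entry_linear.
case: (dof_der _) => [l|].
  by rewrite mpoly.mderivD mpoly.mderivZ mulrDl -scalerAl linearP.
by rewrite mulrDl -scalerAl linearP.
Qed.

(** The codes test against monomials whereas [B] is an arbitrary basis, so the monomials are
    expanded in [B]. Only the entries with i <= j carry degrees of freedom; symmetry gives the
    others. *)
Lemma dofs_sep (s : set_type (@Sigma R k)) :
  (forall i, (i < size (dofs k T B))%N -> (dofs k T B)`_i s = 0) ->
  set_val s = 0.
Proof.
move=> h; set f := set_val s; have sS : Sigma k f by exact: set_valP.
have h' g E i : g \in dof_kinds k -> spans E (unzip1 (dof_tests g)) ->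
    (i < size (tests g E))%N -> dof T g E (tests g E)`_i f = 0.
  move=> gk gE iB.
  have qI : (g, E, (tests g E)`_i) \in index.
    apply/flattenP; exists [seq (g, E, p) | p <- tests g E].
      by apply/allpairsPdep; exists g, E; rewrite mem_filter gE mem_enum.
    by apply/mapP; exists (tests g E)`_i => //; exact: mem_nth.
  move: qI => /(nthP (DofKind 0 0 None [::], cell_entity, 0))[m mI mE].
  have mD : (m < size (dofs k T B))%N by rewrite size_map.
  rewrite -[RHS](h m mD) /dofs.
  by rewrite (nth_map (DofKind 0 0 None [::], cell_entity, 0))// mE.
have ent0 (i j : 'I_3) : (i <= j)%N -> (fun x => f x i j) = 0.
  move=> ij; have [p dp fp] := Sigma_entry hk i j sS.
  rewrite fp (tens_eq0 (p := p)); first exact: linear0.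
  move=> L; apply: (entry_vanish hk (T := T) (fx := fun=> None) ij _ dp) => //.
  move=> q g gk gi gj qg _.
  have fp' : (fun x => f x (dof_row g) (dof_col g)) = mfun p by rewrite gi gj.
  have [qd _ _] := qg.
  rewrite -(dof_codeE T fp' qd).
  have gE := code_for_spans qg; have := code_for_test R qg.
  have h0 := h' g (ent_code q) _ gk gE; rewrite /tests in h0.
  case: ifP h0 => [_ h0 -> |_ h0 qQ]; first exact: (h0 0%N).
  have hb := hB (ent_code q) gk.
  have [r hr] : exists r : 'I_(size (B g (ent_code q))) -> mpoly3 R,
      forall i : 'I_(size (B g (ent_code q))), (B g (ent_code q))`_i = mfun (r i).
    apply: (@fin_all_exists _ _ (fun (i : 'I_(size (B g (ent_code q)))) r =>
      (B g (ent_code q))`_i = mfun r)) => n.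
    by have /QpolyP[r _ ->] := hb.1 n (ltn_ord n); exists r.
  have [c [-> _]] := hb.2 _ qQ.
  rewrite (_ : \sum_i _ = mfun (\sum_i c 0 i *: r i)); last first.
    by rewrite linear_sum; apply: eq_bigr => n _; rewrite linearZ hr.
  rewrite (dofE _ _ _ fp') mulr_sumr linear_sum big1// => n _.
  rewrite -scalerAr linearZ/= -(dofE _ _ _ fp') -hr h0 ?mulr0//.
apply/funext => x; apply/matrixP => i j; rewrite mxE.
have [ij|ji] := leqP i j; first exact: (congr1 (fun f => f x) (ent0 i j ij)).
have [st _ _] := sS; rewrite -st mxE.
exact: (congr1 (fun f => f x) (ent0 j i (ltnW ji))).
Qed.

(** An upper bound is enough: as many independent monomial fields as functionals can then be
    selected, and the separation makes them generate the space. *)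
Lemma size_dofs : (size (dofs k T B) <= #|sindices k|)%N.
Proof.
rewrite card_sindices// -(sum_dof_kinds hk) size_map size_flatten /shape sumnE big_map.
rewrite big_allpairs_dep/= !big_seq; apply: leq_sum => g gk.
rewrite big_seq; apply: (@leq_trans
  (\sum_(E <- ents g | E \in ents g) \prod_n qdim (deg (dof_tests g) n))%N).
  apply: leq_sum => E _; rewrite size_map /tests.
  case: nilP => [->|_]; last exact: basis_Qpoly_size (hB E gk).
  by rewrite big1// => n _; rewrite deg_nil.
rewrite -big_seq big_const_seq count_predT iter_addn_0 /ents card_spans.
rewrite mulnC -big_split/= leq_prod// => n _.
case: ifPn => [_|ng]; first by rewrite mul1n.
by rewrite deg_notin.
Qed.

End Unisolvence.

Lemma unisolventP (R : realType) k (T : cuboid R) : (3 <= k)%N -> unisolvent k T.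
Proof.
move=> hk B hB.
have sz := size_dofs T hk hB.
apply: (@dual_basis R _ _ (@Sigma0 R k) (@Sigma_linear R k) _
  ((fun i => sfield (enum_val i)) \o widen_ord sz)).
- by move=> i; apply: sfield_Sigma => //; exact: enum_valP.
- apply: indep_inj; last exact: sfield_indep T.
  by move=> i j /(congr1 val) /= ij; apply/val_inj.
- by move=> i; exact: dofs_dual.
- exact: dofs_sep.
Qed.

(** * Traces on the faces of a mesh *)

Definition single_valued (R : realType) (k : nat) (Th : set (cuboid R))
    (P : cuboid R -> 'rV[R]_3 -> 'M[R]_3) :=
  forall T T' (E E' : entity), Th T -> Th T' ->
  E <> cell_entity -> E' <> cell_entity -> points T E = points T' E' ->
  forall g, g \in dof_kinds k -> spans E (unzip1 (dof_tests g)) ->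
  forall p, (if nilp (dof_tests g) then p = cst 1
             else @Qpoly R (dof_tests g) p) ->
  dof T g E p (P T) = dof T' g E' p (P T').

Section Traces.
Variable R : realType.
Implicit Types (T : cuboid R) (E : entity) (x : 'rV[R]_3).

Lemma set_coordE x i t m : set_coord x i t 0 m = if m == i then t else x 0 m.
Proof. by rewrite mxE. Qed.

Definition entity_itv T E (m : 'I_3) (t : R) :=
  match E m with
  | Some b => t = bound T b m
  | None => lo T 0 m <= t <= hi T 0 m
  end.

(** The set of points is a product of intervals and single points; moving one coordinate of the base
    point [y] recovers each factor. An interval is not a point because cuboids are nondegenerate. *)
Lemma points_eq T T' E E' m : points T E = points T' E' ->
  match E m, E' m with
  | None, None => lo T 0 m = lo T' 0 m /\ hi T 0 m = hi T' 0 m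
  | Some c, Some c' => bound T c m = bound T' c' m
  | _, _ => False
  end.
Proof.
move=> eTE.
pose y : 'rV[R]_3 := \row_i bound T (odflt false (E i)) i.
have yE i : entity_itv T E i (y 0 i).
  rewrite /entity_itv mxE; case: (E i) => //=.
  by rewrite lexx ltW// cuboid_lt.
have yE' : points T' E' y by rewrite -eTE.
have itvE t : entity_itv T E m t <-> entity_itv T' E' m t.
  have h1 : entity_itv T E m t <-> points T E (set_coord y m t).
    split=> [h i|/(_ m)]; rewrite set_coordE; last by rewrite eqxx.
    by case: eqP => [->|_]; [exact: h|exact: yE].
  have h2 : entity_itv T' E' m t <-> points T' E' (set_coord y m t).
    split=> [h i|/(_ m)]; rewrite set_coordE; last by rewrite eqxx.
    by case: eqP => [->|_]; [exact: h|exact: yE'].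
  by rewrite h1 h2 eTE.
have lt1 := cuboid_lt T m; have lt2 := cuboid_lt T' m.
move: itvE; rewrite /entity_itv.
case: (E m) => [c|]; case: (E' m) => [c'|] h.
- by have /h := erefl (bound T c m).
- have /h e1 : lo T' 0 m <= lo T' 0 m <= hi T' 0 m by rewrite lexx ltW.
  have /h e2 : lo T' 0 m <= hi T' 0 m <= hi T' 0 m by rewrite lexx andbT ltW.
  by move: lt2; rewrite e1 e2 ltxx.
- have /h e1 : lo T 0 m <= lo T 0 m <= hi T 0 m by rewrite lexx ltW.
  have /h e2 : lo T 0 m <= hi T 0 m <= hi T 0 m by rewrite lexx andbT ltW.
  by move: lt1; rewrite e1 e2 ltxx.
- have /h /andP[a1 a2] : lo T 0 m <= lo T 0 m <= hi T 0 m by rewrite lexx ltW.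
  have /h /andP[a3 a4] : lo T 0 m <= hi T 0 m <= hi T 0 m by rewrite lexx andbT ltW.
  have /h /andP[b1 b2] : lo T' 0 m <= lo T' 0 m <= hi T' 0 m by rewrite lexx ltW.
  have /h /andP[b3 b4] : lo T' 0 m <= hi T' 0 m <= hi T' 0 m by rewrite lexx andbT ltW.
  by split; apply/eqP; rewrite eq_le ?a1 ?b1 ?a4 ?b4.
Qed.

Variables (k : nat) (Th : set (cuboid R)) (P : cuboid R -> 'rV[R]_3 -> 'M[R]_3).
Hypothesis hk : (3 <= k)%N.
Hypothesis SP : forall T, Th T -> Sigma k (P T).
Hypothesis PD : single_valued k Th P.

(** The difference of the two polynomials, with x_n frozen, is tested by the codes with a value in
    x_n, whose entities lie on the common face. A derivative can then only be tangential, and it is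
    taken at the same points from both cells. *)
Lemma face_trace T T' E E' n c x i j : Th T -> Th T' ->
  points T E = points T' E' ->
  (forall m, (E m == None) = (m != n)) -> E n = Some c -> x 0 n = bound T c n ->
  ~~ ((i == n) && (j == n)) -> P T x i j = P T' x i j.
Proof.
move=> hT hT' eTE En Ec xn; wlog ij : i j / (i <= j)%N.
  move=> h; have [/h//|ji] := leqP i j; rewrite andbC => /(h _ _ (ltnW ji)).
  have sy T0 : Th T0 -> P T0 x i j = P T0 x j i.
    by move=> /SP[+ _ _] => /(_ x) e; rewrite -{1}e mxE.
  by rewrite (sy T hT) (sy T' hT').
move=> nij.
have [p dp pE] := Sigma_entry hk i j (SP hT).
have [p' dp' pE'] := Sigma_entry hk i j (SP hT').
have -> : P T x i j = mfun p x by rewrite -pE.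
have -> : P T' x i j = mfun p' x by rewrite -pE'.
apply/eqP; rewrite -subr_eq0; apply/eqP.
rewrite /mfun -mpoly.mevalB meval_tens -scaleN1r addrC.
pose fx m := if m == n then Some c else None.
have Eeq m : m != n -> [/\ E m = None, E' m = None, lo T 0 m = lo T' 0 m
    & hi T 0 m = hi T' 0 m].
  move=> mn; have := points_eq m eTE; have := En m; rewrite mn.
  by case: (E m) => // _; case: (E' m) => // -[].
have [c' Ec' cc'] : exists2 c', E' n = Some c' & bound T c n = bound T' c' n.
  by have := points_eq n eTE; rewrite Ec; case: (E' n) => // c' ?; exists c'.
apply: (entry_vanish hk (T := T) (fx := fx) ij).
- by move=> e; rewrite /fx; case: eqP => // e'; move: nij; rewrite -e e' eqxx.
- exact: deg_ltP.
- move=> q g gk gi gj qg qfx; rewrite linearP/= mulN1r.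
  have qn : q n = Ev c by apply: qfx; rewrite /fx eqxx.
  (* The face may be the upper end of one cell and the lower end of the other, so the code seen from
     [T'] may differ in x_n. *)
  pose q' m := if m == n then Ev c' else q m.
  have q'n : q' n = Ev c' by rewrite /q' eqxx.
  have q'm m : m != n -> q' m = q m by rewrite /q' => /negbTE ->.
  have gE := code_for_spans qg; have gt := code_for_test R qg.
  have [qd _ _] := qg.
  have qd' m : (if q' m is Der _ then true else false) = (dof_der g == Some m).
    rewrite -qd; have [->|mn] := eqVneq m n; first by rewrite q'n qn.
    by rewrite q'm.
  have eqp : points T (ent_code q) = points T' (ent_code q').
    apply/seteqP; split=> y hy m; have := hy m; rewrite !ffunE;
    have [->|mn] := eqVneq m n; rewrite ?q'n ?qn ?cc'// q'm//;
    have [_ _ l h] := Eeq m mn;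
    by case: (q m) => [[]|[]|?]; rewrite /bound ?l ?h.
  have nc (f : code) b : f n = Ev b -> ent_code f <> cell_entity.
    by move=> fn /ffunP/(_ n); rewrite !ffunE fn.
  have pE1 : (fun x => P T x (dof_row g) (dof_col g)) = mfun p by rewrite gi gj.
  have pE2 : (fun x => P T' x (dof_row g) (dof_col g)) = mfun p' by rewrite gi gj.
  have := PD hT hT' (nc _ _ qn) (nc _ _ q'n) eqp gk gE gt.
  rewrite (dof_codeE T pE1 qd).
  have -> : mon_code q = mon_code q'.
    apply/mpoly.mnmP => m; rewrite !mon_codeE.
    by have [->|mn] := eqVneq m n; rewrite ?q'n ?qn ?q'm.
  rewrite (dof_codeE T' pE2 qd') => ->.
  apply/eqP; rewrite addrC subr_eq0; apply/eqP; apply: eq_tens => m e.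
  rewrite /code_form; have [->|mn] := eqVneq m n.
    by rewrite q'n qn /fval /=; congr (_.[_]); move: cc'; rewrite /bound.
  by rewrite q'm//; have [_ _ l h] := Eeq m mn; rewrite l h.
- by move=> m b; rewrite /fx; case: eqP => // -> [<-]; rewrite xn.
Qed.

End Traces.

(** Classical equality, so that cells can be collected in duplicate-free lists. *)
HB.instance Definition _ (R : realType) := gen_eqMixin (cuboid R).

(** * Lines through the mesh in a coordinate direction *)

Section Lines.
Variables (R : realType) (k : nat) (Omega : set 'rV[R]_3) (Th : set (cuboid R)).
Variable P : cuboid R -> 'rV[R]_3 -> 'M[R]_3.
Hypothesis hk : (3 <= k)%N.
Hypothesis oOmega : open Omega.
Hypothesis mesh : is_mesh Omega Th.
Hypothesis SP : forall T, Th T -> Sigma k (P T).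
Hypothesis PD : single_valued k Th P.

(** Two distinct cells meet in a proper vertex, edge or face of [T], which has no point in the
    interior of [T]. *)
Lemma open_cell_inj T T' z : Th T -> Th T' -> open_cell T z -> cell T' z -> T = T'.
Proof.
move=> hT hT' oz cz; have [_ _ _ h] := mesh; apply: contrapT => TT'.
have czT : cell T z.
  by move=> m; rewrite /cell_entity ffunE; have /andP[/ltW -> /ltW ->] := oz m.
have [|E [E' [Ec _ eE _]]] := h _ _ hT hT' TT'; first by exists z.
have : points T E z by rewrite -eE.
move=> pz; apply: Ec; apply/ffunP => m; rewrite ffunE.
have := pz m; have /andP[l1 l2] := oz m; case: (E m) => // b e.
by move: l1 l2; rewrite e /bound; case: b {e}; rewrite ltxx.
Qed.

Lemma seq_gap (s : seq R) t :
  exists2 d, 0 < d & forall r, r \in s -> r != t -> d < `|r - t|.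
Proof.
elim: s => [|a s [d d0 hd]]; first by exists 1.
have [->|at_] := eqVneq a t.
  by exists d => // r; rewrite inE => /orP[/eqP ->|/hd//]; rewrite eqxx.
exists (Num.min d (`|a - t| / 2)).
  by rewrite lt_min d0 divr_gt0// normr_gt0 subr_eq0.
move=> r; rewrite inE gt_min => /orP[/eqP ->|rs] rt.
  by apply/orP; right; rewrite ltr_pdivrMr// ltr_pMr ?normr_gt0 ?subr_eq0// ltr1n.
by rewrite hd.
Qed.

(** A condition on the line through [x] in the direction x_n: it meets the interior of [T]. *)
Definition crosses (n : 'I_3) (x : 'rV[R]_3) (T : cuboid R) :=
  [forall m, (m != n) ==> (lo T 0 m < x 0 m < hi T 0 m)].

Lemma crossesP n (x : 'rV[R]_3) T :
  reflect (forall m, m != n -> lo T 0 m < x 0 m < hi T 0 m) (crosses n x T).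
Proof. by apply: (iffP forallP) => h m; [exact/implyP|apply/implyP/h]. Qed.

Lemma open_shift n (x : 'rV[R]_3) t : Omega (set_coord x n t) ->
  exists2 e, 0 < e & forall d, `|d| < e -> Omega (set_coord x n (t + d)).
Proof.
move=> Ot; have /nbhs_ballP[e /= e0 he] := open_nbhs_nbhs (conj oOmega Ot).
exists e => // d de; apply: he; split=> // i j; rewrite ord1 !set_coordE.
case: eqP => _; last exact: ballxx.
by rewrite /ball/= opprD addrA subrr add0r normrN.
Qed.

(* The point is interior to the cell [T] in the directions other than x_n, so it
   lies in the relative interior of a face of [T], which by the face-to-face
   property is also a face of the cell on the other side. *)
Lemma next_cell (c : bool) n x t T : Th T -> crosses n x T -> bound T c n = t ->
  Omega (set_coord x n t) ->
  exists T', [/\ Th T', crosses n x T', bound T' (~~ c) n = t &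
    forall i j, ~~ ((i == n) && (j == n)) ->
      P T (set_coord x n t) i j = P T' (set_coord x n t) i j].
Proof.
move=> hT /crossesP cT bT Oy; set y := set_coord x n t.
have [fTh cover _ hmesh] := mesh.
have /finite_seqP[cs Thcs] := fTh.
have [e e0 he] := open_shift Oy.
(* Apart from t itself, no cell has an end in x_n within [d0] of t, so a cell found slightly beyond
   t extends back to t. *)
have [d0 d00 hd0] := seq_gap (flatten [seq [:: lo T 0 n; hi T 0 n] | T <- cs]) t.
have hb b T' : Th T' -> bound T' b n != t -> d0 < `|bound T' b n - t|.
  move=> hT' bt; apply: hd0 => //; apply/flatten_mapP; exists T'.
    by move: hT'; rewrite Thcs.
  by rewrite /bound; case: b {bt}; rewrite !inE eqxx ?orbT.
pose d := Num.min e d0 / 2.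
have d_gt0 : 0 < d by rewrite divr_gt0// lt_min e0.
have de : d < e by rewrite ltr_pdivrMr// gt_min; apply/orP; left; lra.
have dd0 : d < d0 by rewrite ltr_pdivrMr// gt_min; apply/orP; right; lra.
(* The shift leads out of [T], past its end at t. *)
pose sg := if c then d else - d.
have sgd : `|sg| = d by rewrite /sg; case: c {bT sg}; rewrite ?normrN gtr0_norm.
have /subset_closure : Omega (set_coord x n (t + sg)) by apply: he; rewrite sgd.
rewrite cover => -[T' hT' cy'].
have hm m : m != n -> lo T' 0 m <= x 0 m <= hi T' 0 m.
  by move=> mn; have := cy' m; rewrite ffunE set_coordE (negbTE mn).
have hn : lo T' 0 n <= t + sg <= hi T' 0 n.
  by have := cy' n; rewrite ffunE set_coordE eqxx.
have hlo : lo T' 0 n != t -> d < `|lo T' 0 n - t|.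
  by move=> h; rewrite (lt_trans dd0)//; exact: (hb false).
have hhi : hi T' 0 n != t -> d < `|hi T' 0 n - t|.
  by move=> h; rewrite (lt_trans dd0)//; exact: (hb true).
have [T'c T'nc] : (if c then lo T' 0 n <= t else t <= hi T' 0 n) /\
   (if c then t < hi T' 0 n else lo T' 0 n < t).
  move: hn; rewrite /sg; case: {bT sg sgd cy'} c => /andP[h1 h2]; split.
  - have [->//|/hlo] := eqVneq (lo T' 0 n) t; rewrite ltr_normr => /orP[]; lra.
  - lra.
  - have [->//|/hhi] := eqVneq (hi T' 0 n) t; rewrite ltr_normr => /orP[]; lra.
  - lra.
have cyT' : cell T' y.
  move=> m; rewrite ffunE set_coordE; have [->|mn] := eqVneq m n; last exact: hm.
  by case: (c) T'c T'nc => [-> /ltW ->|-> /ltW ->].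
have cyT : cell T y.
  move=> m; rewrite ffunE set_coordE; have [->|mn] := eqVneq m n.
    by rewrite -bT /bound; have /ltW := cuboid_lt T n; case: (c) => ->; rewrite lexx.
  by have /andP[/ltW -> /ltW ->] := cT m mn.
have TT' : T <> T'.
  move=> e'; move: bT T'nc; rewrite -e' /bound; case: (c) => ->; by rewrite ltxx.
have [|E [E' [Ec _ eE eE']]] := hmesh _ _ hT hT' TT'; first by exists y.
have eP : points T E = points T' E' by rewrite -eE.
have py : points T E y by rewrite -eE.
have Em m : m != n -> E m = None.
  move=> mn; have := py m; case: (E m) => // b; rewrite set_coordE (negbTE mn).
  by have /andP[+ +] := cT m mn => + + e'; rewrite e' /bound; case: b {e'}; rewrite ltxx.
have [c1 Ec1] : exists c1, E n = Some c1.
  case En : (E n) => [c1|]; first by exists c1.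
  case: Ec; apply/ffunP => m; rewrite ffunE.
  by have [->|/Em] := eqVneq m n.
have tc1 : t = bound T c1 n by have := py n; rewrite Ec1 set_coordE eqxx.
(* So far [x] lies only weakly between the bounds of [T']; the common face has the extents of both
   cells, which makes this strict. *)
have cT' : crosses n x T'.
  apply/crossesP => m mn; have := points_eq m eP; rewrite (Em m mn).
  by case: (E' m) => // -[<- <-]; exact: cT.
exists T'; split=> //.
  have := points_eq n eP; rewrite Ec1 -tc1; case: (E' n) => // c2.
  move: T'nc; rewrite /bound; case: (c); case: c2 => //= + e'; by rewrite e' ltxx.
move=> i j; apply: (face_trace hk SP PD hT hT' eP _ Ec1).
- move=> m; have [->|mn] := eqVneq m n; first by rewrite Ec1.
  by rewrite Em.
- by rewrite set_coordE eqxx.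
Qed.

(** Just inside the common end the line runs through the interior of both cells; [z] is halfway from
    that end to the nearer of the opposite ends. *)
Lemma crosses_inj c n x T T' : Th T -> Th T' -> crosses n x T -> crosses n x T' ->
  bound T c n = bound T' c n -> T = T'.
Proof.
move=> hT hT' /crossesP cT /crossesP cT' b.
pose z := if c then (Num.max (lo T 0 n) (lo T' 0 n) + hi T 0 n) / 2
          else (Num.min (hi T 0 n) (hi T' 0 n) + lo T 0 n) / 2.
have [z1 z2] : lo T 0 n < z < hi T 0 n /\ lo T' 0 n < z < hi T' 0 n.
  have l1 := cuboid_lt T n; have l2 := cuboid_lt T' n.
  move: b; rewrite /z /bound; case: (c) => b.
    by have [?|?] := leP (lo T 0 n) (lo T' 0 n); split; apply/andP; split; lra.
  by have [?|?] := leP (hi T 0 n) (hi T' 0 n); split; apply/andP; split; lra.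
apply: (@open_cell_inj _ _ (set_coord x n z)) => // m; rewrite ?ffunE set_coordE.
  by have [->//|mn] := eqVneq m n; exact: cT.
have [->|mn] := eqVneq m n; first by case/andP: z2 => /ltW -> /ltW ->.
by have /andP[/ltW -> /ltW ->] := cT' m mn.
Qed.

Lemma big_single (I : eqType) (s : seq I) (A : pred I) (F : I -> R) a : uniq s ->
  a \in s -> A a -> (forall b, b \in s -> A b -> b = a) ->
  \sum_(b <- s | A b) F b = F a.
Proof.
move=> us sa Aa h; rewrite big_mkcond (bigD1_seq a)//= Aa big_seq_cond big1 ?addr0//.
by move=> b /andP[bs ba]; case: ifP => // /(h _ bs) e; rewrite e eqxx in ba.
Qed.

(* Inside [Omega] the upper end of a cell on the line is the lower end of another
   one, with the same value there; outside of [Omega], [phi] is zero. *)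
Lemma line_sum (cs : seq (cuboid R)) (phi : 'rV[R]_3 -> R) n x i j :
  uniq cs -> Th = [set` cs] -> (forall y, ~ Omega y -> phi y = 0) ->
  ~~ ((i == n) && (j == n)) ->
  let F T t := P T (set_coord x n t) i j * phi (set_coord x n t) in
  \sum_(T <- cs | crosses n x T) (F T (hi T 0 n) - F T (lo T 0 n)) = 0.
Proof.
move=> us Thcs hphi ij F.
have inT T : T \in cs -> Th T by rewrite Thcs.
have Tin T : Th T -> T \in cs by rewrite Thcs.
pose ts := undup (flatten [seq [:: lo T 0 n; hi T 0 n] | T <- cs]).
have inb c T : T \in cs -> bound T c n \in ts.
  move=> Ts; rewrite mem_undup; apply/flatten_mapP; exists T => //.
  by rewrite /bound; case: c; rewrite !inE eqxx ?orbT.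
(* The sum over the cells with upper end ([c] true) or lower end ([c] false) at t; it has at most
   one term. *)
pose H c t := \sum_(T <- cs | crosses n x T && (bound T c n == t)) F T t.
have HE c : \sum_(T <- cs | crosses n x T) F T (bound T c n) = \sum_(t <- ts) H c t.
  rewrite /H; under [RHS]eq_bigr do rewrite big_mkcondr.
  rewrite exchange_big/= big_seq_cond [RHS]big_seq_cond; apply: eq_bigr => T /andP[Ts _].
  rewrite -big_mkcond/= (@big_single _ ts _ (F T) (bound T c n)) ?undup_uniq ?inb//.
  by move=> b _ /eqP.
rewrite big_split/= sumrN (HE true) (HE false).
apply/eqP; rewrite subr_eq0; apply/eqP; apply: eq_bigr => t _.
have [Oy|nOy] := pselect (Omega (set_coord x n t)); last first.
  by rewrite /H !big1// => T _; rewrite /F hphi ?mulr0.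
have Huniq c T : T \in cs -> crosses n x T -> bound T c n = t -> H c t = F T t.
  move=> Ts cT bT; apply: big_single => //; first by rewrite cT bT eqxx.
  move=> T' T's /andP[cT' /eqP bT']; apply: (@crosses_inj c n x) => //; try exact: inT.
  by rewrite bT bT'.
have Hnext c T : T \in cs -> crosses n x T -> bound T c n = t -> H c t = H (~~ c) t.
  move=> Ts cT bT; have [T' [hT' cT' bT' e]] := next_cell (inT _ Ts) cT bT Oy.
  by rewrite (Huniq _ _ Ts cT bT) (Huniq _ _ (Tin _ hT') cT' bT') /F e.
have [/hasP[T Ts /andP[cT /eqP bT]]|h1] :=
    boolP (has (fun T => crosses n x T && (bound T true n == t)) cs).
  exact: (Hnext true _ Ts cT bT).
have [/hasP[T Ts /andP[cT /eqP bT]]|h2] :=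
    boolP (has (fun T => crosses n x T && (bound T false n == t)) cs).
  by rewrite (Hnext false _ Ts cT bT).
by rewrite /H !big_hasC.
Qed.

End Lines.

(** * Integration over cells *)

Section Boxes.
Variable R : realType.
Local Notation mR := (measurableTypeR R).
Local Notation R3 := (mR * mR * mR)%type.
Implicit Types (T : cuboid R) (f g : 'rV[R]_3 -> R).

Lemma ptE (z : R3) i : pt z 0 i = nth 0 [:: z.1.1; z.1.2; z.2] i.
Proof. by rewrite mxE. Qed.

Lemma measurable_box (A : 'I_3 -> set mR) : (forall i, measurable (A i)) ->
  measurable (@pt R @^-1` [set x | forall i, A i (x 0 i)] : set R3).
Proof.
move=> mA; rewrite (_ : _ @^-1` _ = (A 0 `*` A 1) `*` A 2%:R).
  by do 2?apply: measurableX.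
apply/seteqP; split=> [z /= h|z [/= [h0 h1] h2]].
  by split; [split; [have := h 0|have := h 1]|have := h 2%:R]; rewrite ptE.
by apply: (@forall_uniq3 0 1 2%:R) => //; rewrite ptE.
Qed.

Lemma open_cell_boxE T :
  open_cell T = [set x | forall i, [set` `]lo T 0 i, hi T 0 i[] (x 0 i)].
Proof. by apply/seteqP; split=> x h i; have := h i; rewrite /= in_itv. Qed.

Lemma measurable_open_cell T : measurable (@pt R @^-1` open_cell T : set R3).
Proof.
rewrite open_cell_boxE.
by apply: (@measurable_box (fun i => [set` `]lo T 0 i, hi T 0 i[])) => i.
Qed.

Lemma leb3_open_cell T : (@leb3 R (@pt R @^-1` open_cell T) < +oo)%E.
Proof.
rewrite (_ : _ @^-1` _ = (`]lo T 0 0, hi T 0 0[ `*` `]lo T 0 1, hi T 0 1[)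
  `*` `]lo T 0 2%:R, hi T 0 2%:R[).
  have m (a b : R) : measurable (`]a, b[%classic : set mR) by exact: measurable_itv.
  have fin (a b : R) : (@lebesgue_measure R `]a, b[%classic \is a fin_num).
    by rewrite lebesgue_measure_itv /=; case: ifP.
  have e2 := product_measure1E (@lebesgue_measure R) (@lebesgue_measure R)
    (m (lo T 0 0) (hi T 0 0)) (m (lo T 0 1) (hi T 0 1)).
  have e3 := product_measure1E (@leb2 R) (@lebesgue_measure R)
    (measurableX (m (lo T 0 0) (hi T 0 0)) (m (lo T 0 1) (hi T 0 1)))
    (m (lo T 0 2%:R) (hi T 0 2%:R)).
  apply: (eq_ind_r (fun r => (r < +oo)%E) _ e3).
  apply: (eq_ind_r (fun r => (r * _ < +oo)%E) _ e2).
  rewrite ltey_eq; apply/orP; left.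
  by do 2?apply: fin_numM; exact: fin.
apply/seteqP; split=> [z /= h|z [/= [h0 h1] h2]].
  by split; [split; [have := h 0|have := h 1]|have := h 2%:R]; rewrite ptE /= in_itv.
by apply: (@forall_uniq3 0 1 2%:R) => //; rewrite ptE /=; move: h0 h1 h2; rewrite !in_itv.
Qed.

Lemma cell_bounded T g : continuous g ->
  exists M, forall x, cell T x -> `|g x| <= M.
Proof.
move=> cg; have cT : compact (cell T).
  have := @rV_compact R 3 (fun i => `[lo T 0 i, hi T 0 i]%classic)
    (fun i => @segment_compact _ _ _).
  congr compact; apply/seteqP; split=> x h i; have := h i; rewrite /= in_itv/=.
    by rewrite ffunE.
  by rewrite /cell_entity ffunE.
have /compact_bounded[M [_ hM]] := continuous_compact (continuous_subspaceT cg) cT.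
exists (M + 1) => x cx; apply: (hM (M + 1)); first by rewrite ltrDl.
by exists x.
Qed.

(** Continuity refers to row vectors, measurability to the product of three lines. They are linked
    by writing an open set as a countable union of boxes with rational centres. *)
Lemma measurable_pt g : continuous g -> measurable_fun setT (g \o @pt R : R3 -> R).
Proof.
move=> /continuousP cg; apply: (measurability _ (RGenOpens.measurableE R)).
move=> _ [_ [a [b ->] <-]]; rewrite setTI.
pose O := g @^-1` `]a, b[%classic.
have oO : open O by apply: cg; exact: interval_open.
rewrite -[X in measurable X]/(@pt R @^-1` O).
pose Q := (rat * rat * rat * nat)%type.
pose itv (q : Q) (i : 'I_3) : set mR :=
  ball (ratr (nth 0 [:: q.1.1.1; q.1.1.2; q.1.2] i) : R) q.2.+1%:R^-1.
pose box (q : Q) := [set x : 'rV[R]_3 | forall i, itv q i (x 0 i)].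
pose F n := if (unpickle n : option Q) is Some q then
  if `[< box q `<=` O >] then box q else set0 else set0.
have OE : O = \bigcup_n F n; last first.
  rewrite OE preimage_bigcup.
  apply: bigcupT_measurable => n; rewrite /F.
  case: unpickle => [q|]; last by rewrite preimage_set0.
  case: ifP => _; last by rewrite preimage_set0.
  apply: (@measurable_box (itv q)) => i.
  exact: measurable_ball.
apply/seteqP; split=> [x Ox|x [n _]]; last first.
  rewrite /F; case: unpickle => [q|] //; case: asboolP => [h|_] //; exact: h.
have /nbhs_ballP[e /= e0 he] := open_nbhs_nbhs (conj oO Ox).
  (* Two points of a box of radius less than e / 2 are less than e apart, so a box of this size
     around x stays in the open set. *)
  have [n ne] : exists n, n.+1%:R^-1 < e / 2.
    have e2 : 0 < e / 2 by rewrite divr_gt0.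
    have [N _ hN] := near_infty_natSinv_lt (PosNum e2).
    by exists N; exact: (hN N (leqnn N)).
  have ni : 0 < n.+1%:R^-1 :> R by rewrite invr_gt0.
  have near i : exists q : rat, ball (ratr q : R) n.+1%:R^-1 (x 0 i).
    have [q] := rat_in_itvoo (ltr_pwDr ni (lexx (x 0 i))).
    rewrite in_itv/= => /andP[q1 q2]; exists q.
    move: q1 q2; rewrite /ball/= ltr_norml; move: (n.+1%:R^-1) (x 0 i) => r y q1 q2.
    apply/andP; split; lra.
  have [q0 h0] := near 0; have [q1 h1] := near 1; have [q2 h2] := near 2%:R.
  have [q bx qn] : exists2 q : Q, box q x & q.2 = n.
    by exists (q0, q1, q2, n) => //; apply: (@forall_uniq3 0 1 2%:R).
  exists (pickle q); first by [].
  rewrite /F pickleK asboolT// => y hy; apply: he; split=> // i j; rewrite ord1.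
  rewrite -qn in ne.
  by apply: ball_splitr; apply: (le_ball (ltW ne)); [exact: bx|exact: hy].
Qed.

Definition cell_fun T g (z : R3) : R := \1_(open_cell T) (pt z) * g (pt z).

Lemma cell_funE T g :
  cell_fun T g = (g \o @pt R : R3 -> R) \_ (@pt R @^-1` open_cell T).
Proof.
rewrite patch_indic; apply/funext => z; rewrite /cell_fun /= mulrC.
by congr (_ * _); rewrite !indicE; congr (_ %:R); rewrite !mem_setE.
Qed.

Lemma integrable_cell_fun T g : continuous g ->
  (@leb3 R).-integrable setT (EFin \o cell_fun T g).
Proof.
move=> cg; rewrite cell_funE -restrict_EFin.
apply/integrable_restrict => //; first exact: measurable_open_cell.
rewrite setTI; apply: measurable_bounded_integrable.
- exact: measurable_open_cell.
- exact: leb3_open_cell.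
- by apply: measurable_funTS; exact: measurable_pt.
- have [M hM] := cell_bounded T cg; exists M; split; first exact: num_real.
  move=> x Mx z Tz /=; rewrite (le_trans _ (ltW Mx))//; apply: hM => i.
  by rewrite ffunE; have /andP[/ltW -> /ltW ->] := Tz i.
Qed.

Lemma measurable_cell_fun T g : continuous g -> measurable_fun setT (cell_fun T g).
Proof.
by move=> cg; apply/measurable_EFinP; have /integrableP[] := integrable_cell_fun T cg.
Qed.

(** An indicator is its own square, so the square of [cell_fun T g] is [cell_fun T] of g^2, which is
    integrable. *)
Lemma Lfun_cell_fun T g : continuous g -> cell_fun T g \in Lfun (@leb3 R) 2%:E.
Proof.
move=> cg; have cg2 : continuous (fun x => g x * g x).
  by move=> x; apply: continuousM; exact: cg.
have /integrableP[_ fin] := integrable_cell_fun T cg2.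
rewrite inE; apply/andP; split; rewrite inE /=; first exact: measurable_cell_fun.
rewrite /finite_norm unlock /Lnorm; apply: poweR_lty.
apply: le_lt_trans fin; rewrite le_eqVlt; apply/orP; left; apply/eqP.
apply: eq_integral => z _ /=; congr (_%:E).
rewrite powR_mulrn// -normrX /cell_fun exprMn expr2 normrM.
rewrite [RHS]normrM expr2; congr (_ * _).
by rewrite indicE -natrM mulnb andbb.
Qed.

End Boxes.

(** * Fubini's theorem with a prescribed innermost direction *)

Section Fubini.
Variable R : realType.
Local Notation mR := (measurableTypeR R).
Local Notation R3 := (mR * mR * mR)%type.
Local Notation leb := (@lebesgue_measure R).

Lemma pt_set_coord0 (a b c : mR) : pt (a, b, c) = set_coord (pt (0 : mR, b, c)) 0 a.
Proof.
apply/rowP; apply: (@forall_uniq3 0 1 2%:R) => //; by rewrite set_coordE !ptE.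
Qed.

Lemma pt_set_coord1 (a b c : mR) : pt (a, b, c) = set_coord (pt (a, 0 : mR, c)) 1 b.
Proof.
apply/rowP; apply: (@forall_uniq3 0 1 2%:R) => //; by rewrite set_coordE !ptE.
Qed.

Lemma pt_set_coord2 (a b c : mR) : pt (a, b, c) = set_coord (pt (a, b, 0 : mR)) 2%:R c.
Proof.
apply/rowP; apply: (@forall_uniq3 0 1 2%:R) => //; by rewrite set_coordE !ptE.
Qed.

(** The measure is built as (x_1, x_2), then x_3. For the direction x_3 Fubini is applied once. For
    the others x_3 is outermost; almost every slice in (x_1, x_2) is integrable, so that Fubini
    applies again on it. *)
Lemma integral_lines_eq0 (n : 'I_3) (f : 'rV[R]_3 -> R) :
  (@leb3 R).-integrable setT (EFin \o (f \o @pt R)) ->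
  (forall x, \int[leb]_t (f (set_coord x n t))%:E = 0)%E ->
  (\int[@leb3 R]_z (f (pt z))%:E = 0)%E.
Proof.
move=> intf h.
have G0 : (forall z : mR, (@leb2 R).-integrable setT (fun w => (f (pt (w, z)))%:E) ->
    \int[@leb2 R]_w (f (pt (w, z)))%:E = 0)%E ->
    (\int[@leb3 R]_z (f (pt z))%:E = 0)%E.
  move=> hz; rewrite -[LHS](integral21_prod_meas1 intf).
  rewrite (ae_eq_integral (cst 0%E)) ?integral0//.
    exact: measurable_fubini_G intf.
  by apply: filterS (ae_integrable2 intf) => z iz _; exact: hz.
move: n h; apply: (@forall_uniq3 0 1 2%:R) => // h.
- apply: G0 => z iz; rewrite -[LHS](integral21_prod_meas1 iz).
  rewrite -[RHS](integral0 leb setT); apply: eq_integral => y _.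
  rewrite -[RHS](h (pt (0 : mR, y, z))) /fubini_G; apply: eq_integral => x _.
  by rewrite -pt_set_coord0.
- apply: G0 => z iz; rewrite -[LHS](integral12_prod_meas1 iz).
  rewrite -[RHS](integral0 leb setT); apply: eq_integral => x _.
  rewrite -[RHS](h (pt (x, 0 : mR, z))) /fubini_F; apply: eq_integral => y _.
  by rewrite -pt_set_coord1.
- rewrite -[LHS](integral12_prod_meas1 intf).
  rewrite -[RHS](integral0 (@leb2 R) setT); apply: eq_integral => -[x y] _.
  rewrite -[RHS](h (pt (x, y, 0 : mR))) /fubini_F; apply: eq_integral => z _.
  by rewrite -pt_set_coord2.
Qed.

End Fubini.

(** * Derivatives and integrals along a line *)

Section LineIntegrals.
Variable R : realType.
Implicit Types (T : cuboid R) (f g : 'rV[R]_3 -> R).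
Local Notation leb := (@lebesgue_measure R).

Lemma is_derive_line f (x : 'rV[R]_3) n (t : R) :
  derivable f (set_coord x n t) (delta_mx 0 n) ->
  is_derive t 1 (fun t => f (set_coord x n t)) (partial n f (set_coord x n t)).
Proof.
have e : (fun h : R => h^-1 *: (((fun t => f (set_coord x n t)) \o shift t) (h *: 1)
      - f (set_coord x n t))) =
    (fun h => h^-1 *: ((f \o shift (set_coord x n t)) (h *: delta_mx 0 n)
      - f (set_coord x n t))).
  apply/funext => h /=; congr (_ *: (f _ - _)); apply/rowP => m.
  rewrite set_coordE !mxE eqxx /=; case: eqP => _; first by rewrite /GRing.scale/= !mulr1.
  by rewrite mulr0 add0r.
move=> df; split; first by rewrite /derivable e.
by rewrite /derive e.
Qed.

Lemma set_coord_continuous (x : 'rV[R]_3) n : continuous (set_coord x n).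
Proof.
move=> t A /nbhs_ballP[e /= e0 eA]; apply/nbhs_ballP; exists e => // s ts.
apply: eA; split=> // i j; rewrite ord1 !set_coordE.
by case: eqP => // _; exact: ballxx.
Qed.

Lemma line_FTC f (x : 'rV[R]_3) n a b : a < b ->
  (forall y, derivable f y (delta_mx 0 n)) -> continuous (partial n f) ->
  (\int[leb]_(t in `[a, b]) (partial n f (set_coord x n t))%:E)%E =
  (f (set_coord x n b) - f (set_coord x n a))%:E.
Proof.
move=> ab df cf; pose F t := f (set_coord x n t).
have dF (t : R) : is_derive t 1 F (partial n f (set_coord x n t)).
  exact/is_derive_line/df.
have cF : continuous F.
  move=> t; apply: differentiable_continuous; apply/derivable1_diffP.
  by have [] := dF t.
rewrite EFinB; apply: (continuous_FTC2 (F := F)) => //.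
- apply: continuous_subspaceT => t; apply: continuous_comp; last exact: cf.
  exact: set_coord_continuous.
- split=> [t _| |].
  + by have [] := dF t.
  + exact/cvg_at_right_filter/cF.
  + exact/cvg_at_left_filter/cF.
- move=> t _; rewrite derive1E; by have [_ ->] := dF t.
Qed.

End LineIntegrals.

(** * Conformity *)

Section Regularity.
Variable R : realType.
Implicit Types (p : mpoly3 R) (f g : 'rV[R]_3 -> R).

Lemma mfun_continuous p : continuous (mfun p).
Proof.
have CD (q r : mpoly3 R) : continuous (mfun q) -> continuous (mfun r) ->
    continuous (mfun (q + r)).
  move=> hq hr; rewrite (_ : mfun _ = mfun q \+ mfun r).
    by move=> x; apply: continuousD; [exact: hq|exact: hr].
  by apply/funext => x; rewrite /mfun mpoly.mevalD.
have CM (q r : mpoly3 R) : continuous (mfun q) -> continuous (mfun r) ->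
    continuous (mfun (q * r)).
  move=> hq hr; rewrite (_ : mfun _ = mfun q \* mfun r).
    by move=> x; apply: continuousM; [exact: hq|exact: hr].
  by apply/funext => x; rewrite /mfun mpoly.mevalM.
have CC (c : R) : continuous (mfun (mpoly.mpolyC 3 c)).
  rewrite (_ : mfun _ = cst c); first exact: cst_continuous.
  by apply/funext => x; rewrite /mfun mpoly.mevalC.
have CX l : continuous (mfun (R := R) 'X^{mpoly.mnm1 l}).
  rewrite (_ : mfun _ = fun x => x 0 l); first exact: coord_continuous.
  by apply/funext => x; rewrite /mfun mpoly.mevalXU.
exact: (mpoly_ring_ind (D := fun q => continuous (mfun q)) CC CD CM CX p).
Qed.

Definition C1_in n f := [/\ continuous f, forall x, derivable f x (delta_mx 0 n)
  & continuous (partial n f)].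

Lemma mfun_C1 n p : C1_in n (mfun p).
Proof.
split; first exact: mfun_continuous.
- by move=> x; have [] := is_derive_mfun p x n.
- by rewrite partial_mfun; exact: mfun_continuous.
Qed.

Lemma Sigma_C1 k (s : 'rV[R]_3 -> 'M[R]_3) i j n : (3 <= k)%N -> Sigma k s ->
  C1_in n (fun x => s x i j).
Proof. by move=> hk /(Sigma_entry hk i j)[p _ ->]; exact: mfun_C1. Qed.

Lemma partialM n f g : C1_in n f -> C1_in n g ->
  partial n (f \* g) = (f \* partial n g) \+ (partial n f \* g).
Proof.
move=> [_ df _] [_ dg _]; apply/funext => x.
by rewrite /partial -[f \* g]/(f * g) deriveM//= /GRing.scale/= [g x * _]mulrC.
Qed.

Lemma C1_inM n f g : C1_in n f -> C1_in n g -> C1_in n (f \* g).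
Proof.
move=> hf hg; have [cf df pf] := hf; have [cg dg pg] := hg; split.
- by move=> x; apply: continuousM; [exact: cf|exact: cg].
- by move=> x; rewrite -[f \* g]/(f * g); apply: derivableM.
- rewrite partialM// => x; apply: continuousD.
    by apply: continuousM; [exact: cf|exact: pg].
  by apply: continuousM; [exact: pf|exact: cg].
Qed.

End Regularity.

(** * Coordinate planes are null sets *)

Section Planes.
Variable R : realType.
Local Notation mR := (measurableTypeR R).
Local Notation R3 := (mR * mR * mR)%type.

Lemma ae_off_plane (i : 'I_3) (r : R) :
  {ae @leb3 R, forall z, pt z 0 i <> r}.
Proof.
pose A (m : 'I_3) : set mR := if m == i then [set r] else setT.
have mA m : measurable (A m) by rewrite /A; case: ifP.
exists ((A 0 `*` A 1) `*` A 2%:R); split.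
- by do 2?apply: measurableX.
- have e2 := product_measure1E (@lebesgue_measure R) (@lebesgue_measure R)
    (mA 0) (mA 1).
  have e3 := product_measure1E (@leb2 R) (@lebesgue_measure R)
    (measurableX (mA 0) (mA 1)) (mA 2%:R).
  apply: (eq_trans e3); apply: (eq_trans (congr1 (fun x => (x * _)%E) e2)).
  have A0 : @lebesgue_measure R (A i) = 0%E.
    by rewrite /A eqxx; exact: lebesgue_measure_set1.
  move: i @A mA e2 e3 A0; apply: (@forall_uniq3 0 1 2%:R) => // A mA _ _ A0.
  + by rewrite [X in (X * _ * _)%E]A0 !mul0e.
  + by rewrite [X in (_ * X * _)%E]A0 mule0 mul0e.
  + by rewrite [X in (_ * X)%E]A0 mule0.
- move=> z /= /contrapT zr; have zA m : A m (pt z 0 m).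
    by rewrite /A; case: eqP => // ->.
  by split; [split; [have := zA 0|have := zA 1]|have := zA 2%:R]; rewrite ptE.
Qed.

Lemma ae_off_planes (i : 'I_3) (s : seq R) :
  {ae @leb3 R, forall z, forall r, r \in s -> pt z 0 i <> r}.
Proof.
elim: s => [|a s IH]; first exact: aeW.
have F := @ae_filter_ringOfSetsType _ _ _ (@leb3 R).
apply: filterS2 IH (ae_off_plane i a) => z h1 h2 r.
by rewrite inE => /orP[/eqP ->//|]; exact: h1.
Qed.

End Planes.

(** * Gluing the cells and the distributional curl *)

Section Conformity.
Variables (R : realType) (k : nat) (Omega : set 'rV[R]_3) (cs : seq (cuboid R)).
Variable P : cuboid R -> 'rV[R]_3 -> 'M[R]_3.
Local Notation mR := (measurableTypeR R).
Local Notation R3 := (mR * mR * mR)%type.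
Local Notation leb := (@lebesgue_measure R).
Local Notation Th := [set` cs].
Hypothesis hk : (3 <= k)%N.
Hypothesis ucs : uniq cs.
Hypothesis oOmega : open Omega.
Hypothesis mesh : is_mesh Omega Th.
Hypothesis SP : forall T, Sigma k (P T).
Hypothesis PD : single_valued k Th P.

Definition cell_sum (g : cuboid R -> 'rV[R]_3 -> R) (z : R3) : R :=
  \sum_(T <- cs) cell_fun T (g T) z.

Lemma integrable_cell_sum g : (forall T, continuous (g T)) ->
  (@leb3 R).-integrable setT (EFin \o cell_sum g).
Proof.
move=> cg; rewrite (_ : _ \o _ = fun z => \sum_(T <- cs) (cell_fun T (g T) z)%:E)%E.
  by apply: integrable_sum => // T _; exact: integrable_cell_fun.
by apply/funext => z; rewrite /cell_sum /= sumEFin.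
Qed.

Lemma line_cell_fun T n x (f : 'rV[R]_3 -> R) :
  (fun t => ((\1_(open_cell T) (set_coord x n t) * f (set_coord x n t))%:E)) =
  if crosses n x T then
    (EFin \o (fun t => f (set_coord x n t))) \_ `]lo T 0 n, hi T 0 n[
  else cst 0%E.
Proof.
apply/funext => t; rewrite indicE; case: ifPn => [/crossesP cT|ncT].
  rewrite patchE /=; case: ifPn => [|tT].
    rewrite inE/= in_itv/= => tT; rewrite mem_set ?mul1r// => m.
    by rewrite set_coordE; have [->//|mn] := eqVneq m n; exact: cT.
  rewrite memNset ?mul0r// => /(_ n); rewrite set_coordE eqxx => h.
  by move: tT; rewrite notin_setE/= in_itv.
rewrite memNset ?mul0r// => h; case/negP: ncT; apply/crossesP => m mn.
by have := h m; rewrite set_coordE (negbTE mn).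
Qed.

Lemma cell_sum_partial_eq0 phi n i j : C1_in n phi ->
  (forall y, ~ Omega y -> phi y = 0) -> ~~ ((i == n) && (j == n)) ->
  (\int[@leb3 R]_z
     (cell_sum (fun T => partial n ((fun y => P T y i j) \* phi)) z)%:E = 0)%E.
Proof.
move=> Cphi phi0 ij; pose f T := (fun y => P T y i j) \* phi.
have Cf T : C1_in n (f T) by apply: C1_inM => //; exact: Sigma_C1 (SP T).
have cpf T : continuous (partial n (f T)) by have [] := Cf T.
apply: (@integral_lines_eq0 R n
  (fun x => \sum_(T <- cs) \1_(open_cell T) x * partial n (f T) x)).
  exact: (integrable_cell_sum (g := fun T => partial n (f T)) cpf).
move=> x.
have cl T : continuous (fun t => partial n (f T) (set_coord x n t)).
  by move=> t; apply: continuous_comp; [exact: set_coord_continuous|exact: cpf].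
have int_oo T : leb.-integrable `]lo T 0 n, hi T 0 n[
    (EFin \o (fun t => partial n (f T) (set_coord x n t))).
  apply: (@integrableS _ _ _ leb `[lo T 0 n, hi T 0 n]) => //.
    exact: subset_itv_oo_cc.
  apply: continuous_compact_integrable; first exact: segment_compact.
  exact: continuous_subspaceT.
under eq_integral do rewrite -sumEFin.
rewrite integral_sum//; last first.
  move=> T; rewrite line_cell_fun; case: ifP => _; last exact: integrable0.
  by apply/integrable_restrict => //; rewrite setTI.
rewrite -[RHS]/(0%:E) -(line_sum hk oOmega mesh (fun T _ => SP T) PD
  x ucs erefl phi0 ij).
rewrite [in RHS]big_mkcond -sumEFin; apply: eq_bigr => T _.
rewrite line_cell_fun; case: ifP => _; last by rewrite integral0.
(* Adding the end points, a null set, prepares for the fundamental theorem of calculus. *)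
rewrite -integral_mkcond integral_itv_obnd_cbnd; last first.
  by have /integrableP[] := int_oo T.
rewrite integral_itv_bndo_bndc; last first.
  apply: (@measurable_funS _ _ _ _ `[lo T 0 n, hi T 0 n]) => //.
    by apply: subset_itvl; rewrite bnd_simp.
  apply/measurable_EFinP; apply: measurable_funTS.
  exact: continuous_measurable_fun.
by have [_ df _] := Cf T; rewrite (line_FTC _ (cuboid_lt T n)).
Qed.

Lemma L2_cell_sum (g : cuboid R -> 'rV[R]_3 -> R) : (forall T, continuous (g T)) ->
  L2 Omega (fun x => \sum_(T <- cs) \1_(open_cell T) x * g T x).
Proof.
move=> cg; have [_ _ sub _] := mesh; rewrite /L2.
rewrite (_ : _ \o _ = \sum_(T <- cs) cell_fun T (g T)).
  have p12 : (1 <= 2%:E :> \bar R)%E by rewrite lee_fin ler1n.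
  have [L0 LD] := Lfun_addr_closed (@leb3 R) p12.
  elim/big_ind : _ => [|f h Lf Lh|T _]; [exact: L0|exact: LD|].
  exact: Lfun_cell_fun.
apply/funext => z; rewrite fct_sumE /= mulr_sumr big_seq [RHS]big_seq.
apply: eq_bigr => T Tcs; rewrite /cell_fun mulrA; congr (_ * _).
(* The open cells lie in the domain, so its indicator is absorbed. *)
rewrite !indicE -natrM mulnb; congr (_ %:R); congr nat_of_bool.
rewrite andbC; case: (boolP (_ \in open_cell T)) => //= /set_mem oT.
by rewrite mem_set//; exact: sub Tcs _ oT.
Qed.

(** The measurable representative: it vanishes off the open cells, where the given field may take
    any values. *)
Definition glued (x : 'rV[R]_3) : 'M[R]_3 :=
  \sum_(T <- cs) \1_(open_cell T) x *: P T x.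

Lemma gluedE x i j :
  glued x i j = \sum_(T <- cs) \1_(open_cell T) x * P T x i j.
Proof. by rewrite summxE; apply: eq_bigr => T _; rewrite mxE. Qed.

Definition glued_curl (x : 'rV[R]_3) : 'M[R]_3 :=
  \matrix_(r, m) \sum_(T <- cs) \1_(open_cell T) x *
    (partial (m + 1) (fun y => P T y r (m + 2%:R)) x
     - partial (m + 2%:R) (fun y => P T y r (m + 1)) x).

(** By the product rule the two integrands differ by d_(m+1) (u_(m+2) phi) - d_(m+2) (u_(m+1) phi),
    taken cell by cell. Column m + 2 is differentiated in direction m + 1 and conversely, so an
    entry (n, n) never meets the direction n, and both terms have integral zero. *)
Lemma glued_weak_curl : weak_curl Omega glued glued_curl.
Proof.
move=> phi [sm [K [_ KO phiK]]] r m.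
have phi0 y : ~ Omega y -> phi y = 0 by move=> ny; apply: phiK => /KO.
have Cphi n : C1_in n phi.
  have [c d] := sm [::]; have [c' _] := sm [:: n].
  by split=> // x; exact: d.
have CP T i j n := @Sigma_C1 R k (P T) i j n hk (SP T).
have m12 : m + 1 != m + 2%:R by case: m => -[|[|[|]]].
have m21 : m + 2%:R != m + 1 by rewrite eq_sym.
pose K1 := cell_sum (fun T => partial (m + 1) ((fun y => P T y r (m + 2%:R)) \* phi)).
pose K2 := cell_sum (fun T => partial (m + 2%:R) ((fun y => P T y r (m + 1)) \* phi)).
pose B := cell_sum (fun T => ((fun y => P T y r (m + 1)) \* partial (m + 2%:R) phi)
                     \- ((fun y => P T y r (m + 2%:R)) \* partial (m + 1) phi)).
have iK (i j n : 'I_3) : (@leb3 R).-integrable setT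
    (EFin \o cell_sum (fun T => partial n ((fun y => P T y i j) \* phi))).
  apply: integrable_cell_sum => T.
  by have [] := C1_inM (CP T i j n) (Cphi n).
have iB : (@leb3 R).-integrable setT (EFin \o B).
  apply: integrable_cell_sum => T y; apply: continuousB; apply: continuousM.
  - by have [+ _ _] := CP T r (m + 1) m; exact.
  - by have [_ _ +] := Cphi (m + 2%:R); exact.
  - by have [+ _ _] := CP T r (m + 2%:R) m; exact.
  - by have [_ _ +] := Cphi (m + 1); exact.
have K10 : \int[@leb3 R]_z K1 z = 0.
  by rewrite /Rintegral cell_sum_partial_eq0// negb_and m21 orbT.
have K20 : \int[@leb3 R]_z K2 z = 0.
  by rewrite /Rintegral cell_sum_partial_eq0// negb_and m12 orbT.
transitivity (\int[@leb3 R]_z (B z + K1 z - K2 z)).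
  apply: eq_Rintegral => z _; rewrite mxE mulr_suml /B /K1 /K2 /cell_sum.
  rewrite -big_split -sumrB /=; apply: eq_bigr => T _; rewrite /cell_fun !partialM//=.
  by ring.
have iBK : (@leb3 R).-integrable setT (EFin \o (fun z => B z + K1 z)).
  rewrite (_ : _ \o _ = (EFin \o B) \+ (EFin \o K1))%E//.
  by apply: integrableD => //; exact: iK.
rewrite RintegralB//; last exact: iK.
rewrite RintegralD//; last exact: iK.
rewrite K10 K20 addr0 subr0; apply: eq_Rintegral => z _.
rewrite !gluedE !mulr_suml -sumrB; apply: eq_bigr => T _; rewrite /cell_fun /=.
by ring.
Qed.

Lemma glued_Hcurl (s : 'rV[R]_3 -> 'M[R]_3) :
  (forall T, Th T -> forall x, open_cell T x -> s x = P T x) -> Hcurl Omega s.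
Proof.
move=> sP; have [_ cover _ _] := mesh; exists glued; split.
(* Off the finitely many planes that carry the faces, a point of the domain is in exactly one open
   cell. *)
- pose bs (i : 'I_3) := flatten [seq [:: lo T 0 i; hi T 0 i] | T <- cs].
  have F := @ae_filter_ringOfSetsType _ _ _ (@leb3 R).
  have : {ae @leb3 R, forall z, forall i r, r \in bs i -> pt z 0 i <> r}.
    apply: filterS2 (ae_off_planes 0 (bs 0)) (filterI (ae_off_planes 1 (bs 1))
      (ae_off_planes 2%:R (bs 2%:R))) => z h0 [h1 h2].
    by apply: (@forall_uniq3 0 1 2%:R).
  apply: filterS => z hz Oz; have := subset_closure Oz.
  rewrite cover => -[T Tcs cT].
  have inbs i b : bound T b i \in bs i.
    apply/flatten_mapP; exists T => //.
    by rewrite /bound; case: b; rewrite !inE eqxx ?orbT.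
  have oT : open_cell T (pt z).
    move=> i; have := cT i; rewrite ffunE => /andP[l h].
    have /eqP nl := hz i _ (inbs i false); have /eqP nh := hz i _ (inbs i true).
    by rewrite lt_neqAle l eq_sym nl lt_neqAle h nh.
  rewrite (sP T)// /glued (bigD1_seq T)//= indicE mem_set// scale1r.
  rewrite big_seq_cond big1 ?addr0// => T' /andP[T'cs T'T].
  rewrite indicE memNset ?scale0r// => oT'.
  case/eqP: T'T; apply: (open_cell_inj mesh T'cs Tcs oT' cT).
- move=> i j.
  rewrite (_ : (fun x => _) = fun x => \sum_(T <- cs) \1_(open_cell T) x * P T x i j).
    by apply: L2_cell_sum => T; have [] := Sigma_C1 i j 0 hk (SP T).
  by apply/funext => x; rewrite gluedE.
- move=> x _; apply/matrixP => i j; rewrite mxE !gluedE.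
  apply: eq_bigr => T _; have [+ _ _] := SP T => /(_ x) e.
  by rewrite -{1}e mxE.
- exists glued_curl; split; last exact: glued_weak_curl.
  move=> r m; rewrite (_ : (fun x => _) = fun x => \sum_(T <- cs) \1_(open_cell T) x *
     (partial (m + 1) (fun y => P T y r (m + 2%:R)) x
     - partial (m + 2%:R) (fun y => P T y r (m + 1)) x)).
    apply: (@L2_cell_sum (fun T => partial (m + 1) (fun y => P T y r (m + 2%:R))
     \- partial (m + 2%:R) (fun y => P T y r (m + 1)))) => T x; apply: continuousB.
      by have [_ _ +] := Sigma_C1 r (m + 2%:R) (m + 1) hk (SP T); exact.
    by have [_ _ +] := Sigma_C1 r (m + 1) (m + 2%:R) hk (SP T); exact.
  by apply/funext => x; rewrite mxE.
Qed.

End Conformity.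

Theorem proposition3p8 (R : realType) (k : nat) (hk : (3 <= k)%N) :
  (forall T : cuboid R, unisolvent k T) /\
  (forall (Omega : set 'rV[R]_3) (Th : set (cuboid R)),
     open Omega -> connected Omega -> contractible Omega ->
     lipschitz_boundary Omega -> is_mesh Omega Th ->
     fe_space k Th `<=` Hcurl Omega).
Proof.
split=> [T|Omega Th oO _ _ _ mesh s [P [SP sP sv]]]; first exact: unisolventP.
have [/finite_seqP[cs0 Thcs0] _ _ _] := mesh.
pose cs := undup cs0.
have Thcs : Th = [set` cs].
  by rewrite Thcs0; apply/seteqP; split=> T /=; rewrite mem_undup.
(* Extension by zero, so that [P'] takes its values in the shape function space for every cuboid. *)
pose P' T := if T \in cs then P T else 0.
have P'E T : T \in cs -> P' T = P T by rewrite /P' => ->.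
rewrite Thcs in mesh SP sP sv.
apply: (@glued_Hcurl R k Omega cs P' hk (undup_uniq _) oO mesh).
- move=> T; rewrite /P'; case: ifPn => [|_]; [exact: SP|exact: Sigma0].
- by move=> T T' E E' hT hT'; rewrite !P'E//; exact: sv.
- by move=> T hT x; rewrite P'E//; exact: sP.
Qed.
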